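(* There exists $\kappa>0$ such that, for any $m\ge1$, $$\mathrm B^{\rm mult}_{\mathbb C,m}\le\kappa\, m^{\frac{1-\gamma}{2}},$$ where $\gamma$ is the Euler--Mascheroni constant.
   Context: For $m\ge1$, $\mathrm B^{\rm mult}_{\mathbb C,m}$ is the optimal (smallest) constant $C_m\ge1$ such that, for all continuous $m$-linear forms $L:c_0\times\cdots\times c_0\to\mathbb C$ (with $c_0$ the complex Banach space of null sequences with the sup norm, and $(e_i)$ its canonical basis), $$\Big(\sum_{i_1,\dots,i_m=1}^\infty|L(e_{i_1},\dots,e_{i_m})|^{\frac{2m}{m+1}}\Big)^{\frac{m+1}{2m}}\le C_m\|L\|,$$ where $\|L\|$ is the supremum of $|L|$ on the product of the unit balls. Such a finite constant exists (the multilinear Bohnenblust--Hille inequality). *)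

(* Defs.v *)
From HB Require Import structures.
From mathcomp Require Import all_boot all_order all_algebra.
From mathcomp Require Import complex.
From mathcomp Require Import all_classical all_reals all_analysis.

Set Implicit Arguments.
Unset Strict Implicit.
Unset Printing Implicit Defensive.

Import Order.TTheory GRing.Theory Num.Theory.
Import numFieldNormedType.Exports.
Import ComplexField.Normc.

Local Open Scope classical_set_scope.
Local Open Scope complex_scope.
Local Open Scope ring_scope.

(* [R[i]] carries no topology in the library: the alias [R[i]^o] does, with
   the norm [`|z| : R[i]]; the real-valued modulus is [normc z : R]. *)

Lemma cvg0_lin (K : numFieldType) (V : normedModType K) (a : K)
    (u v : nat -> V) :
  u @ \oo --> (0 : V) -> v @ \oo --> (0 : V) ->
  (a *: u + v) @ \oo --> (0 : V).
Proof.
move=> u0 v0; have -> : (0 : V) = a *: 0 + 0 by rewrite scaler0 addr0.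
by apply: cvgD => //; exact: cvgZl_tmp.
Qed.

Section NullSequences.
Context {R : realType}.
Implicit Types (u v : nat -> R[i]^o) (z : R[i]).

Lemma normC_normc z : `|z| = (normc z)%:C.
Proof. by []. Qed.

Lemma normc_ge0 z : 0 <= normc z.
Proof. by case: z => a b; exact: sqrtr_ge0. Qed.

Lemma ler_normcD z1 z2 : normc (z1 + z2) <= normc z1 + normc z2.
Proof. by rewrite -lecR rmorphD /= -!normC_normc ler_normD. Qed.

Definition null_seq : {pred nat -> R[i]^o} :=
  mem [set u : nat -> R[i]^o | u @ \oo --> (0 : R[i]^o)].
Definition null_seq_key : pred_key null_seq. Proof. exact. Qed.
Canonical null_seq_keyed := KeyedPred null_seq_key.

Lemma null_seqP u : reflect (u @ \oo --> (0 : R[i]^o)) (u \in null_seq).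
Proof. by apply: (iffP idP) => [/set_mem|/mem_set]. Qed.

Lemma null_seq_submod : submod_closed null_seq.
Proof.
split=> [|a u v /null_seqP u0 /null_seqP v0]; apply/null_seqP.
  exact: cvg_cst.
exact: (@cvg0_lin _ (R[i]^o)).
Qed.

HB.instance Definition _ :=
  GRing.isSubmodClosed.Build _ _ null_seq null_seq_submod.

End NullSequences.
Arguments null_seq R : clear implicits.

Record c0 (R : realType) := C0 {
  c0_val :> nat -> R[i]^o;
  c0P : c0_val \in null_seq R }.

HB.instance Definition _ (R : realType) := [isSub for @c0_val R].
HB.instance Definition _ (R : realType) := [Choice of c0 R by <:].
HB.instance Definition _ (R : realType) :=
  [SubChoice_isSubLmodule of c0 R by <:].

Section SupNorm.
Context {R : realType}.
Implicit Types (x y : c0 R).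

Lemma c0_cvg x : x @ \oo --> (0 : R[i]^o).
Proof. exact/null_seqP/c0P. Qed.

(* Embedded in [R[i]] because the norm of a normed space over [R[i]] is
   [R[i]]-valued in the library. *)
Definition c0_norm x : R[i] := (sup (range (fun n => normc (x n))))%:C.

Lemma c0_bounded x : has_ubound (range (fun n => normc (x n))).
Proof.
have /cvgr0Pnorm_lt/(_ 1 ltr01)[N _ xN] := c0_cvg x.
exists (1 + \sum_(i < N) normc (x i)) => _ [n _ <-].
have S0 (P : pred 'I_N) : 0 <= \sum_(i < N | P i) normc (x i).
  by apply: sumr_ge0 => i _; exact: normc_ge0.
have [Nn|nN] := leqP N n.
  rewrite -[leLHS]addr0 lerD// -lecR; exact/ltW/xN.
rewrite (bigD1 (Ordinal nN)) //= addrCA lerDl addr_ge0 //.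
Qed.

Lemma c0_has_sup x : has_sup (range (fun n => normc (x n))).
Proof. by split; [exists (normc (x 0%N)), 0%N | exact: c0_bounded]. Qed.

Lemma le_c0_norm x n : normc (x n) <= sup (range (fun n => normc (x n))).
Proof. by apply: ub_le_sup; [exact: c0_bounded | exists n]. Qed.

Lemma c0_norm_le x (M : R) : (forall n, normc (x n) <= M) ->
  sup (range (fun n => normc (x n))) <= M.
Proof.
by move=> xM; apply: ge_sup => [|_ [n _ <-]//]; exists (normc (x 0%N)), 0%N.
Qed.

Lemma c0_normD x y : c0_norm (x + y) <= c0_norm x + c0_norm y.
Proof.
rewrite /c0_norm -rmorphD lecR; apply: c0_norm_le => n.
by apply: le_trans (ler_normcD _ _) _; rewrite lerD// le_c0_norm.
Qed.

Lemma c0_normZ (a : R[i]) x : c0_norm (a *: x) = `|a| * c0_norm x.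
Proof.
rewrite normC_normc /c0_norm -rmorphM; congr (_%:C).
have aE (n : nat) : normc ((a *: x) n) = normc a * normc (x n).
  exact: normcM.
have [a0|a0] := eqVneq (normc a) 0.
  apply/eqP; rewrite eq_le; apply/andP; split.
    by apply: c0_norm_le => n; rewrite aE a0 !mul0r.
  by rewrite a0 mul0r; apply: le_trans (le_c0_norm _ 0); exact: normc_ge0.
have {}a0 : 0 < normc a by rewrite lt_def a0 normc_ge0.
apply/eqP; rewrite eq_le; apply/andP; split.
  by apply: c0_norm_le => n; rewrite aE ler_pM2l// le_c0_norm.
rewrite -ler_pdivlMl//; apply: c0_norm_le => n.
by rewrite ler_pdivlMl// -aE le_c0_norm.
Qed.

Lemma c0_norm_eq0 x : c0_norm x = 0 -> x = 0.
Proof.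
move=> [x0]; apply: val_inj; apply/funext => n /=.
apply: eq0_normc; apply/eqP; rewrite eq_le normc_ge0 andbT.
by rewrite -x0 le_c0_norm.
Qed.

Lemma c0_basis_subproof (k : nat) :
  (fun n => (n == k)%:R : R[i]^o) \in null_seq R.
Proof.
apply/null_seqP; apply: cvg_near_cst.
by exists k.+1 => // n /= kn; rewrite gtn_eqF.
Qed.

Definition c0_basis (k : nat) : c0 R := C0 (c0_basis_subproof k).

End SupNorm.

HB.instance Definition _ (R : realType) :=
  Lmodule_isNormed.Build R[i] (c0 R)
    (@c0_normD R) (@c0_normZ R) (@c0_norm_eq0 R).

Definition multilinear (R : realType) (m : nat) (L : ('I_m -> c0 R) -> R[i]^o) :=
  forall (i : 'I_m) (x : 'I_m -> c0 R), linear (fun u => L (dfwith x i u)).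

(* [{ptws 'I_m -> c0 R}] is [c0 R ^ m] with its product topology. *)
Definition continuous_form (R : realType) (m : nat)
    (L : ('I_m -> c0 R) -> R[i]^o) :=
  multilinear L /\ continuous (L : {ptws 'I_m -> c0 R} -> R[i]^o).

Local Open Scope ereal_scope.

Definition form_norm (R : realType) (m : nat) (L : ('I_m -> c0 R) -> R[i]^o) :
    \bar R :=
  ereal_sup [set (normc (L x))%:E | x in
    [set x : 'I_m -> c0 R | forall i, (`|x i| <= 1)%R]].

Definition BH_sum (R : realType) (m : nat) (L : ('I_m -> c0 R) -> R[i]^o) :
    \bar R :=
  (\esum_(i in [set: 'I_m -> nat])
     (normc (L (fun j => c0_basis (i j))) `^ (2 * m%:R / m.+1%:R))%:E)
  `^ (m.+1%:R / (2 * m%:R)).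

Definition BH_admissible (R : realType) (m : nat) (C : R) :=
  (1 <= C)%R /\
  forall L : ('I_m -> c0 R) -> R[i]^o,
    continuous_form L -> BH_sum L <= C%:E * form_norm L.

(* The infimum is taken in the extended reals, so that it would be [+oo] if
   there were no admissible constant. *)
Definition BH_mult (R : realType) (m : nat) : \bar R :=
  ereal_inf [set C%:E | C in [set C : R | BH_admissible m C]].

Definition euler_gamma (R : realType) : R :=
  limn (fun n => series harmonic n - ln n%:R)%R.

(* Main.v *)
From HB Require Import structures.
From mathcomp Require Import all_boot all_order all_algebra.
From mathcomp Require Import cyclic separable cyclotomic.
From mathcomp Require Import complex finmap ring lra.
From mathcomp Require Import all_classical all_reals all_analysis.
Require Import Defs.

Set Implicit Arguments.
Unset Strict Implicit.
Unset Printing Implicit Defensive.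
Import Order.TTheory GRing.Theory Num.Theory.
Import numFieldNormedType.Exports.
Local Open Scope classical_set_scope.
Local Open Scope ring_scope.
Import ComplexField.Normc.
Local Open Scope complex_scope.

(** Write B_m for the optimal constant and H_m for the harmonic numbers.  The
proof shows B_m <= exp ((1 - gamma + delta) H_(m-1) / 2) for every delta > 0;
since H_(m-1) <= 1 + ln m, taking delta = 1/m gives a constant times
m ^ ((1 - gamma) / 2).

The bound is a telescoping product.  Let a(i_1, ..., i_m) be the coefficients
of an m-linear form.  By Hoelder's and Loomis and Whitney's inequalities
([blei]), the l^(2m/(m+1)) norm of the array a is controlled by the m mixed
sums, one for each k,
    sum over the i_j with j <> k of (sum over i_k of |a|^2) ^ ((m-1)/m).
In such a mixed sum the inner square function is at most a Khinchine constant
times the average of |sum over i_k of a e_(i_k)|^(2 - 2/m), where the e_i are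
independent and uniform on the unit circle.  For fixed values of the e_i, the
numbers sum over i_k of a e_(i_k) are the coefficients of an (m-1)-linear form
of norm at most ||L||, and 2 - 2/m is precisely the exponent 2(m-1)/m of the
inequality for m-1 factors ([BH_induction]).  So B_m / B_(m-1) is at most the
Khinchine constant for the exponent 2 - 2/m.

As this exponent tends to 2, only the first-order behaviour of the Khinchine
constant at 2 matters.  By convexity of the exponential
([powR_ge_entropy]), a lower bound for E |f|^(2 - 2 theta) follows from an
upper bound for the entropy E |f|^2 ln |f|^2, where f = sum a_i e_i and
sum |a_i|^2 = 1.  The claim is that this entropy is at most 1 - gamma, which is
its value when f is replaced by a standard complex Gaussian variable g:  |g|^2
is exponentially distributed, and the integral of t ln t exp (-t) over the
half-line is 1 - gamma.

The e_i are replaced by Gaussian variables one at a time.  Put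
Phi (u) = u ln u and G (u, s) = E Phi (|v + sqrt s g|^2), where |v|^2 = u and g
is standard complex Gaussian; G has the closed form [gauss_ent_at].  The
replacement step says that the mean of G (|v + a e|^2, s) over |e| = 1 is at
most G (|v|^2, s + |a|^2).  For s = 1 and as functions of r = |a|^2, both sides
agree to first order at r = 0, and their second derivatives compare because the
one on the left, after multiplication by r^2 and two differentiations, is a
Bessel series ([second_deriv_ent_circle_poly_le]); term by term, the inequality
that remains is (1 - t)_+ <= exp (-t) ([inc_gamma2_le]).  Euler's constant
enters through Phi (u) <= G (u, 1), that is, through a comparison of the
exponential integral with a logarithm ([Ein_ge_ln]).

All averages are finite.  A polynomial of degree less than N in |v + a e|^2 has
the same mean over the N-th roots of unity as over the circle
([root_mean_moment]); replacing G by Taylor polynomials therefore costs an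
error that tends to 0 as N grows.  This error, and the one that comes from
starting with a small variance s > 0 in place of 0, are collected in delta. *)

(** * Differentiation rules for real functions *)

(** The rules are stated for functions given by their values, so that
[derive_to] can differentiate a closed formula by matching on its body and
leave an equation between the derivative found and the one claimed. *)

Section Derivatives.
Context {R : realType}.
Implicit Types (f g : R -> R) (x c df dg : R).

Lemma is_derive_cstE c x : is_derive x 1 (fun=> c) 0.
Proof. exact: is_derive_cst. Qed.

Lemma is_derive_idE x : is_derive x 1 (fun y : R => y) 1.
Proof. exact: is_derive_id. Qed.

Lemma is_derive_addE f g x df dg : is_derive x 1 f df -> is_derive x 1 g dg ->
  is_derive x 1 (fun y => f y + g y) (df + dg).
Proof. by move=> ? ?; exact: is_deriveD. Qed.

Lemma is_derive_oppE f x df : is_derive x 1 f df ->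
  is_derive x 1 (fun y => - f y) (- df).
Proof. by move=> ?; exact: is_deriveN. Qed.

Lemma is_derive_mulE f g x df dg : is_derive x 1 f df -> is_derive x 1 g dg ->
  is_derive x 1 (fun y => f y * g y) (df * g x + f x * dg).
Proof.
move=> fx gx; rewrite (_ : (fun y => _) = f * g)//.
by apply: is_derive_eq; rewrite addrC !/GRing.scale/= mulrC.
Qed.

Lemma is_derive_compE (h : R -> R) f x df dh :
  is_derive (f x) 1 h dh -> is_derive x 1 f df ->
  is_derive x 1 (fun y => h (f y)) (dh * df).
Proof.
by move=> ? ?; rewrite (_ : (fun y => _) = h \o f)//; exact: is_derive1_comp.
Qed.

Lemma is_derive_expRE f x df : is_derive x 1 f df ->
  is_derive x 1 (fun y => expR (f y)) (expR (f x) * df).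
Proof. by move=> ?; apply: is_derive_compE. Qed.

Lemma is_derive_lnE f x df : 0 < f x -> is_derive x 1 f df ->
  is_derive x 1 (fun y => ln (f y)) ((f x)^-1 * df).
Proof. by move=> ? ?; apply: is_derive_compE; exact: is_derive1_ln. Qed.

Lemma is_derive_expnE f x df n : is_derive x 1 f df ->
  is_derive x 1 (fun y => f y ^+ n) (n%:R * f x ^+ n.-1 * df).
Proof.
move=> fx; have -> : (fun y => f y ^+ n) = f ^+ n.
  by apply/funext => y; rewrite exprfctE.
exact: is_deriveX.
Qed.

Lemma is_derive_invE f x df : f x != 0 -> is_derive x 1 f df ->
  is_derive x 1 (fun y => (f y)^-1) (- (f x ^+ 2)^-1 * df).
Proof.
by move=> fx0 fx; exact: is_deriveV.
Qed.

Lemma is_derive_sumE (I : Type) (r : seq I) (P : pred I) (h : I -> R -> R)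
    (dh : I -> R) x :
  (forall i, P i -> is_derive x 1 (h i) (dh i)) ->
  is_derive x 1 (fun y => \sum_(i <- r | P i) h i y) (\sum_(i <- r | P i) dh i).
Proof.
move=> hd; elim: r => [|i r ih].
  under eq_fun do rewrite big_nil; rewrite big_nil; exact: is_derive_cstE.
under eq_fun do rewrite big_cons; rewrite big_cons; case: ifP => // Pi.
by apply: is_derive_addE => //; exact: hd.
Qed.

Lemma is_derive_continuous f x df : is_derive x 1 f df ->
  {for x, continuous f}.
Proof.
by move=> fx; apply/differentiable_continuous/derivable1_diffP/ex_derive.
Qed.

(** The sign of the derivative is required in the open interval only: it is
often read off after multiplication by the variable, which vanishes at 0. *)
Lemma le_of_derive_ge0 f f' (a b : R) : a <= b ->
  (forall x, a <= x <= b -> is_derive x 1 f (f' x)) ->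
  (forall x, a < x < b -> 0 <= f' x) -> f a <= f b.
Proof.
move=> ab fd f'0; have [->//|nab] := eqVneq a b.
have ltab : a < b by rewrite lt_neqAle nab.
have fd' x : x \in `]a, b[ -> is_derive x 1 f (f' x).
  by move=> xab; apply: fd; rewrite !ltW ?(itvP xab).
have fc : {within `[a, b], continuous f}.
  apply: continuous_in_subspaceT => x; rewrite inE/= in_itv/= => xab.
  exact: is_derive_continuous (fd x xab).
have [c cab] := MVT ltab fd' fc.
move=> /eqP; rewrite subr_eq => /eqP ->; rewrite lerDr mulr_ge0 ?subr_ge0//.
by apply: f'0; rewrite !(itvP cab).
Qed.

End Derivatives.

Lemma is_derive_change (R : realType) (f : R -> R) (x df df' : R) : df = df' ->
  is_derive x 1 f df -> is_derive x 1 f df'.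
Proof. by move=> ->. Qed.

Ltac derive_rules :=
  repeat first
    [ eassumption | eapply is_derive_cstE | eapply is_derive_idE
    | eapply is_derive_addE | eapply is_derive_oppE
    | eapply is_derive_expRE | eapply is_derive_lnE
    | eapply is_derive_expnE | eapply is_derive_invE
    | eapply is_derive_mulE ].
Ltac derive_to := eapply is_derive_change; [|derive_rules].

(** * Euler's constant and the harmonic numbers *)

Section EulerGamma.
Context {R : realType}.

Lemma ln_succ_ge (n : nat) : n.+2%:R^-1 <= ln n.+2%:R - ln n.+1%:R :> R.
Proof.
rewrite -lerN2 opprB -ln_div ?posrE ?ltr0n//.
have -> : n.+1%:R / n.+2%:R = 1 + (- n.+2%:R^-1) :> R.
  apply: (mulIf (x := n.+2%:R)); rewrite ?pnatr_eq0//.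
  rewrite divfK ?pnatr_eq0// mulrDl mulNr mulVf ?pnatr_eq0// mul1r.
  by rewrite -[n.+2%:R]natr1 addrK.
by apply: le_ln1Dx; rewrite ltrN2 invf_lt1 ?ltr0n// ltr1n.
Qed.

Lemma ln_succ_le (n : nat) : ln n.+2%:R - ln n.+1%:R <= n.+1%:R^-1 :> R.
Proof.
rewrite -ln_div ?posrE ?ltr0n//.
have -> : n.+2%:R / n.+1%:R = 1 + n.+1%:R^-1 :> R.
  apply: (mulIf (x := n.+1%:R)); rewrite ?pnatr_eq0//.
  by rewrite divfK ?pnatr_eq0// mulrDl mulVf ?pnatr_eq0// mul1r natr1.
by apply: le_ln1Dx; rewrite (lt_trans (ltrN10 _)) ?invr_gt0.
Qed.

(* Decreases to Euler's constant. *)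
Let u (n : nat) : R := series harmonic n.+1 - ln n.+1%:R.

Let u0 : u 0%N = 1.
Proof. by rewrite /u /series/= big_nat1 /harmonic/= invr1 ln1 subr0. Qed.

Let u_decr : nonincreasing_seq u.
Proof.
apply/nonincreasing_seqP => n; rewrite /u [series _ n.+2]seriesSr /harmonic/=.
have := ln_succ_ge n.
by move: (series _ _) (n.+2%:R^-1) (ln n.+2%:R) (ln n.+1%:R) => a b c d; lra.
Qed.

Let u_ge0 n : 0 <= u n.
Proof.
have : n.+1%:R^-1 <= u n.
  elim: n => [|n ih]; first by rewrite u0 invr1.
  move: ih; rewrite /u [series _ n.+2]seriesSr /harmonic/=.
  have := ln_succ_le n.
  move: (series _ _) (n.+2%:R^-1) (n.+1%:R^-1) (ln n.+2%:R) (ln n.+1%:R) => a b c d e.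
  by lra.
by apply: le_trans; rewrite invr_ge0.
Qed.

Let u_cvg : cvgn u.
Proof.
by apply: nonincreasing_is_cvgn => //; exists 0 => _ [n _ <-]; exact: u_ge0.
Qed.

Lemma euler_gammaE : euler_gamma R = limn u.
Proof.
apply: cvg_lim => //.
by rewrite -(cvg_shiftS (fun n => series harmonic n - ln n%:R)).
Qed.

Lemma euler_gamma_le (n : nat) :
  euler_gamma R <= series harmonic n.+1 - ln n.+1%:R.
Proof. by rewrite euler_gammaE; exact: nonincreasing_cvgn_ge. Qed.

Lemma euler_gamma_le1 : euler_gamma R <= 1.
Proof. by have := euler_gamma_le 0; rewrite -/(u 0%N) u0. Qed.

Lemma harmonic_le_ln (n : nat) : series harmonic n.+1 <= 1 + ln n.+1%:R :> R.
Proof. by rewrite -lerBlDr; have := u_decr (leq0n n); rewrite u0. Qed.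

End EulerGamma.

(** * The entire exponential integral *)

Section Ein.
Context {R : realType}.
Implicit Types x : R.

(** Ein x is the integral of (1 - exp (-t)) / t over [0, x]; its power series
has the coefficients - (-1)^i / (i i!) for i > 0.  At i = 0 the denominator
vanishes, so that the quotient is 0 as required. *)
Definition ein_coef (i : nat) : R := (-1) ^+ i.+1 / (i%:R * i`!%:R).
Definition Ein x : R := limn (pseries ein_coef x).
Definition dEin x : R := limn (pseries (pseries_diffs ein_coef) x).

Lemma diffs_ein_coef i : pseries_diffs ein_coef i = (-1) ^+ i / i.+1`!%:R.
Proof.
rewrite /pseries_diffs /ein_coef mulrCA invfM mulVKf ?pnatr_eq0//.
by rewrite !exprS mulrA mulrNN !mul1r.
Qed.

Lemma is_cvg_pseries_fact (c : nat -> R) x :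
  (forall i, `|c i| <= i`!%:R^-1) -> cvgn (pseries c x).
Proof.
move=> cle; apply: normed_cvg.
apply: (series_le_cvg _ _ _ (is_cvg_series_exp_coeff `|x|)) => n //=.
  by rewrite /exp_coeff/= mulr_ge0// exprn_ge0.
by rewrite /exp_coeff/= normrM normrX mulrC ler_wpM2l// exprn_ge0.
Qed.

Lemma is_derive_Ein x : is_derive x 1 Ein (dEin x).
Proof.
apply: (@pseries_snd_diffs _ _ (`|x| + 1)).
- apply: is_cvg_pseries_fact => i; rewrite /ein_coef normrM normrX normrN1.
  rewrite expr1n mul1r invfM normrM !ger0_norm// ?invr_ge0//.
  by case: i => [|i]; rewrite ?invr0 ?mul0r// ler_piMl// invf_le1// ler1n.
- apply: is_cvg_pseries_fact => i; rewrite diffs_ein_coef normrM normrX normrN1.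
  rewrite expr1n mul1r ger0_norm ?invr_ge0// lef_pV2 ?posrE ?ltr0n ?fact_gt0//.
  by rewrite ler_nat factS leq_pmull.
- apply: is_cvg_pseries_fact => i; rewrite /pseries_diffs -/(pseries_diffs _ _).
  rewrite diffs_ein_coef !normrM normrX normrN1 expr1n mul1r.
  rewrite !ger0_norm ?invr_ge0//.
  rewrite factS natrM invfM factS natrM invfM.
  rewrite mulrCA [X in _ * X]mulrA mulfV ?pnatr_eq0// mul1r.
  by rewrite ler_piMl// invf_le1// ler1n.
- by rewrite [ltRHS]ger0_norm// ltrDl.
Qed.

(** The defining differential equation of Ein, multiplied by x so that it
also holds at 0. *)
Lemma mul_dEin x : x * dEin x = 1 - expR (- x).
Proof.
suff h : (fun n => x * pseries (pseries_diffs ein_coef) x n) @ \oo -->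
    1 - expR (- x).
  rewrite -(cvg_lim _ h)//; apply/esym/cvg_lim => //.
  apply: cvgM; first exact: cvg_cst.
  apply: is_cvg_pseries_fact => i.
  rewrite diffs_ein_coef normrM normrX normrN1.
  rewrite expr1n mul1r ger0_norm ?invr_ge0// lef_pV2 ?posrE ?ltr0n ?fact_gt0//.
  by rewrite ler_nat factS leq_pmull.
have -> : (fun n => x * pseries (pseries_diffs ein_coef) x n) =
    (fun n => 1 - series (exp_coeff (- x)) n.+1).
  apply/funext => n; rewrite /pseries /series/= big_nat_recl//= [exp_coeff _ _]/exp_coeff/=.
  rewrite expr0 fact0 divr1 opprD addrA subrr add0r -sumrN mulr_sumr.
  apply: eq_bigr => i _; rewrite diffs_ein_coef /exp_coeff/=.
  by rewrite [in RHS]exprNn !exprS; ring.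
apply: cvgB; first exact: cvg_cst.
rewrite (cvg_shiftS (series (exp_coeff (- x)))).
exact: is_cvg_series_exp_coeff.
Qed.

Lemma Ein0 : Ein 0 = 0.
Proof.
rewrite /Ein (_ : pseries _ _ = cst 0) ?lim_cst//.
apply/funext => n; rewrite /pseries /series/= big1// => i _.
by rewrite /ein_coef; case: i => [|i]; rewrite ?mul0r ?invr0 ?mulr0 ?mul0r// expr0n mulr0.
Qed.

End Ein.

(** * Alternating partial sums of the exponential *)

Section ExpSeries.
Context {R : realType}.
Implicit Types x y : R.

Lemma succ_mul_invfact (n : nat) : n.+1%:R * (n.+1`!%:R)^-1 = n`!%:R^-1 :> R.
Proof. by rewrite factS natrM invfM mulVKf// pnatr_eq0. Qed.

Lemma is_derive_series_exp (n : nat) x :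
  is_derive x 1 (fun y => series (exp_coeff y) n.+1) (series (exp_coeff x) n).
Proof.
rewrite /series/=.
under eq_fun do rewrite big_nat_recl//=.
rewrite -[X in is_derive _ _ _ X]add0r; apply: is_derive_addE.
  by rewrite /exp_coeff/=; under eq_fun do rewrite expr0; exact: is_derive_cstE.
rewrite big_mkord; under eq_fun do rewrite big_mkord.
apply: is_derive_sumE => i _; rewrite /exp_coeff/=.
derive_to => /=.
by rewrite mulr0 addr0 mulr1 factS natrM invfM mulrACA divff ?pnatr_eq0// mul1r.
Qed.

Lemma series_exp0 (n : nat) : series (exp_coeff (0 : R)) n.+1 = 1.
Proof.
rewrite /series/= big_nat_recl//= big1 ?addr0 ?/exp_coeff/= ?expr0 ?fact0 ?divr1//.
by move=> i _; rewrite exprS !mul0r.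
Qed.

Lemma series_exp_le (n : nat) x : 0 <= x -> series (exp_coeff x) n <= expR x.
Proof.
move=> x0; apply: nondecreasing_cvgn_le; last exact: is_cvg_series_exp_coeff.
by apply: nondecreasing_series => i _ _; exact: exp_coeff_ge0.
Qed.

(** Taylor polynomials of exp (-x) lie alternately above and below it:
integrating one such inequality over [0, x] gives the next one. *)
Lemma series_exp_alt (K : nat) x : 0 <= x ->
  0 <= (-1) ^+ K * (series (exp_coeff (- x)) K.+1 - expR (- x)).
Proof.
elim: K x => [|K ih] x x0.
  rewrite expr0 mul1r /series/= big_nat1 /exp_coeff/= expr0 fact0 divr1 subr_ge0.
  by rewrite expR_le1 oppr_le0.
have := @le_of_derive_ge0 _ (fun y : R =>
  (-1) ^+ K.+1 * (series (exp_coeff (- y)) K.+2 - expR (- y)))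
  (fun y : R => (-1) ^+ K * (series (exp_coeff (- y)) K.+1 - expR (- y))) 0 x x0.
rewrite oppr0 series_exp0 expR0 subrr mulr0; apply.
- move=> y _.
  have h : is_derive y 1 (fun y => series (exp_coeff (- y)) K.+2)
      (series (exp_coeff (- y)) K.+1 * -1).
    apply: (is_derive_compE (h := fun z => series (exp_coeff z) K.+2)).
      exact: is_derive_series_exp.
  by derive_to; rewrite /= exprS; ring.
- by move=> y /andP[y0 _]; apply: ih; exact: ltW.
Qed.

End ExpSeries.

(** * Entropy of a shifted complex Gaussian variable *)

Section EntropyFunctions.
Context {R : realType}.
Implicit Types (u s x y : R).
Let gamma : R := euler_gamma R.

(** [gauss_ent x] is the mean of Phi (|v + g|^2), where Phi (u) = u ln u,
|v|^2 = x and g is a standard complex Gaussian variable; [gauss_ent_at u s]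
is the same mean for |v|^2 = u and a Gaussian variable of variance s. *)
Definition gauss_ent x : R := (x + 1) * (Ein x - euler_gamma R) + 2 - expR (- x).
Definition gauss_ent_at u s : R :=
  (u + s) * (ln s + Ein (u / s) - euler_gamma R) + s * (2 - expR (- (u / s))).

Lemma is_derive_gauss_ent x :
  is_derive x 1 gauss_ent (Ein x + dEin x + 1 - gamma).
Proof.
have hE := is_derive_Ein x.
derive_to; rewrite /= -/gamma.
by have := mul_dEin x; lra.
Qed.

(** The operator f |-> (x f')' is the Laplacian (up to a factor 4) on radial
functions of a complex variable.  It maps x ln x to ln x + 2, and hence
[gauss_ent] to the Gaussian mean of the latter. *)
Lemma is_derive_gauss_ent2 x :
  is_derive x 1 (fun y => y * (Ein y + dEin y + 1 - gamma)) (Ein x + 2 - gamma).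
Proof.
have -> : (fun y => y * (Ein y + dEin y + 1 - gamma)) =
    (fun y => y * Ein y + (1 - expR (- y)) + (1 - gamma) * y).
  by apply/funext => y; rewrite -mul_dEin; ring.
have hE := is_derive_Ein x.
derive_to; rewrite /=.
by have := mul_dEin x; lra.
Qed.

Lemma dEin_ge0 x : 0 < x -> 0 <= dEin x.
Proof.
by move=> x0; rewrite -(pmulr_rge0 _ x0) mul_dEin subr_ge0 expR_le1 oppr_le0 ltW.
Qed.

Lemma Ein_ge0 x : 0 <= x -> 0 <= Ein x.
Proof.
move=> x0; rewrite -[leLHS]Ein0; apply: (le_of_derive_ge0 x0) => y.
  by move=> _; exact: is_derive_Ein.
by move=> /andP[y0 _]; exact: dEin_ge0.
Qed.

(** If N is a Poisson variable of mean x, then Ein x is the mean of the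
harmonic number H_N.  A partial sum S of the series suffices: the derivative
of exp (-y) S (y) is a partial sum of that of Ein, because passing from H_j
to H_(j+1) leaves the term y^j / (j+1)!. *)
Lemma Ein_ge_series (n : nat) x : 0 <= x ->
  expR (- x) * \sum_(j < n.+1) series harmonic j / j`!%:R * x ^+ j <= Ein x.
Proof.
move=> x0; rewrite -subr_ge0.
pose S y := \sum_(j < n.+1) series harmonic j / j`!%:R * y ^+ j.
pose dS y := \sum_(j < n) series harmonic j.+1 / j`!%:R * y ^+ j.
have Sd y : is_derive y 1 S (dS y).
  rewrite /S; under eq_fun do rewrite big_ord_recl/=.
  rewrite -[dS y]add0r; apply: is_derive_addE.
    by under eq_fun do rewrite expr0; exact: is_derive_cstE.
  apply: is_derive_sumE => i _; rewrite /bump/=.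
  derive_to => /=.
  by rewrite add1n -(succ_mul_invfact i); ring.
pose f y := Ein y - expR (- y) * S y.
pose df y := dEin y - expR (- y) * (dS y - S y).
have fd y : is_derive y 1 f (df y).
  have hE := is_derive_Ein y; have hS := Sd y.
  by derive_to; rewrite /= /df; ring.
have f0 : f 0 = 0.
  rewrite /f Ein0 /S big1 ?mulr0 ?subr0// => -[[|i] ?] _ /=.
    by rewrite /series/= big_geq// !mul0r.
  by rewrite exprS mul0r mulr0.
rewrite -/(S x) -/(f x) -f0; apply: (le_of_derive_ge0 x0) => y /andP[y0 _].
(* The last term of [S] has no partner in [dS] and has the good sign. *)
rewrite -(pmulr_rge0 _ y0) /df mulrBr mul_dEin.
have dSS : y * (dS y - S y) <= expR y - 1.
  rewrite /dS /S big_ord_recr/= opprD addrA -sumrB mulrBr.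
  rewrite (le_trans (y := y * \sum_(j < n) y ^+ j / j.+1`!%:R))//.
    rewrite lerBlDr ler_wpDr//.
      apply: mulr_ge0; first exact: ltW.
      apply: mulr_ge0; last by rewrite exprn_ge0// ltW.
      by rewrite mulr_ge0 ?invr_ge0// sumr_ge0// => i _; rewrite invr_ge0.
    rewrite ler_wpM2l ?(ltW y0)//; apply: ler_sum => i _.
    rewrite [series _ _]seriesSr -mulrBl -mulrBl [_ + _ - _]addrAC subrr add0r.
    rewrite /harmonic/= factS natrM invfM.
    by rewrite mulrC.
  have := series_exp_le n.+1 (ltW y0).
  rewrite /series/= big_nat_recl//= {1}/exp_coeff/= expr0 fact0 divr1.
  rewrite -lerBrDl; apply: le_trans; rewrite big_mkord mulr_sumr.
  by apply: ler_sum => i _; rewrite /exp_coeff/= exprS mulrA.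
have : expR (- y) * (y * (dS y - S y)) <= expR (- y) * (expR y - 1).
  by rewrite ler_wpM2l ?expR_ge0.
rewrite [X in _ <= X]mulrBr -expRD addNr expR0 mulr1; lra.
Qed.

Lemma ln_le_sub1 x : 0 < x -> ln x <= x - 1.
Proof.
move=> x0; have := @le_ln1Dx R (x - 1); rewrite addrCA subrr addr0; apply.
by rewrite ltrBrDr addNr.
Qed.

(** Take Poisson means in H_j >= gamma + ln (j+1) - 1/(j+1) and
ln (j+1) >= ln x + 1 - x/(j+1); the Poisson mean of 1/(N+1) is
(1 - exp (-x)) / x.  This is where Euler's constant enters. *)
Lemma Ein_ge_ln x : 0 < x ->
  gamma + ln x + 1 - (x + 1) * (1 - expR (- x)) / x <= Ein x.
Proof.
move=> x0; rewrite -(ler_pM2l (expR_gt0 x)).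
(* [v n] is exp x times the Poisson mean, truncated at [n], of
   gamma + ln x + 1 - (x + 1) / (j + 1). *)
pose a := gamma + ln x + 1.
pose v n := a * series (exp_coeff x) n.+1 -
  (x + 1) / x * (series (exp_coeff x) n.+2 - 1).
have ecvg : series (exp_coeff x) n @[n --> \oo] --> expR x.
  exact: is_cvg_series_exp_coeff.
have vcvg : v @ \oo --> a * expR x - (x + 1) / x * (expR x - 1).
  apply: cvgB; apply: cvgM; try exact: cvg_cst.
    by rewrite (cvg_shiftS (series (exp_coeff x))).
  apply: cvgB; last exact: cvg_cst.
  rewrite (cvg_shiftS (fun n => series (exp_coeff x) n.+1)).
  by rewrite (cvg_shiftS (series (exp_coeff x))).
have -> : expR x * (gamma + ln x + 1 - (x + 1) * (1 - expR (- x)) / x) =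
    a * expR x - (x + 1) / x * (expR x - 1).
  have : expR x * expR (- x) = 1 by rewrite -expRD subrr expR0.
  move: (expR (- x)) => e he.
  transitivity (a * expR x - (x + 1) / x * (expR x - expR x * e)); last by rewrite he.
  by rewrite /a; ring.
rewrite -(cvg_lim _ vcvg)//; apply: limr_le; first by apply/cvg_ex; eexists; exact: vcvg.
apply: nearW => n.
rewrite -(ler_pM2l (expR_gt0 (- x))) mulrA -expRD addNr expR0 mul1r.
apply: le_trans (Ein_ge_series n (ltW x0)).
rewrite ler_pM2l ?expR_gt0// /v.
have -> : (x + 1) / x * (series (exp_coeff x) n.+2 - 1) =
    \sum_(j < n.+1) (x + 1) / j.+1%:R * (x ^+ j / j`!%:R).
  rewrite /series/= big_nat_recl//= {1}/exp_coeff/= expr0 fact0 divr1.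
  rewrite [1 + _]addrC addrK big_mkord mulr_sumr; apply: eq_bigr => j _.
  rewrite /exp_coeff/= factS natrM invfM exprS.
  by move: (j.+1%:R^-1) (j`!%:R^-1) => a1 a2; field; rewrite gt_eqF.
rewrite /series/= big_mkord mulr_sumr -sumrB.
apply: ler_sum => j _; rewrite /exp_coeff/= -mulrBl [leRHS]mulrAC -mulrA.
rewrite ler_wpM2r//; first by rewrite mulr_ge0 ?invr_ge0// exprn_ge0// ltW.
have h1 := @euler_gamma_le R j.
have h2 : ln (x / j.+1%:R) <= x / j.+1%:R - 1.
  by apply: ln_le_sub1; rewrite divr_gt0.
rewrite ln_div ?posrE// in h2.
move: h1; rewrite seriesSr /harmonic/= -/gamma mulrDl mul1r.
move: h2; rewrite /a (_ : \sum_(0 <= k < j) _ = series harmonic j)//.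
move: (x / j.+1%:R) (j.+1%:R^-1) (ln j.+1%:R) (ln x) (series _ _) => A B C D E.
lra.
Qed.

(** Phi (|z|^2) is not subharmonic near 0, so this is not a case of the mean
value inequality.  For x <= 1 the left side is at most 0 and the right side
increases from 1 - gamma; for x >= 1 the bound [Ein_ge_ln] leaves a sum of
nonnegative terms. *)
Lemma mul_ln_le_gauss_ent x : 0 <= x -> x * ln x <= gauss_ent x.
Proof.
move=> x0; have g1 : gamma <= 1 := euler_gamma_le1.
have [x1|x1] := leP x 1.
  apply: (@le_trans _ _ 0); first by rewrite mulr_ge0_le0// ln_le0.
  apply: (@le_trans _ _ (gauss_ent 0)).
    by rewrite /gauss_ent Ein0 oppr0 expR0 -/gamma; lra.
  apply: (le_of_derive_ge0 (f' := fun y => Ein y + dEin y + 1 - gamma) x0).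
    by move=> y _; exact: is_derive_gauss_ent.
  move=> y /andP[y0 _].
  by have := dEin_ge0 y0; have := Ein_ge0 (ltW y0); lra.
have {}x0 : 0 < x by rewrite (lt_trans _ x1).
have h := Ein_ge_ln x0.
have lnx0 : 0 <= ln x by rewrite ln_ge0// ltW.
(* With [Ein_ge_ln] inserted, Euler's constant cancels. *)
have : (x + 1) * (ln x + 1 - (x + 1) * (1 - expR (- x)) / x) <=
    (x + 1) * (Ein x - gamma) by rewrite ler_wpM2l; lra.
rewrite /gauss_ent -/gamma => h2.
have e0 := expR_gt0 (- x); set e := expR (- x) in h h2 e0 *.
have : (x + 1) * (ln x + 1 - (x + 1) * (1 - e) / x) + 2 - e - x * ln x =
    ln x + (1 - x^-1) + e * (((x + 1) ^+ 2 - x) / x).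
  by field; rewrite gt_eqF.
have : 0 <= 1 - x^-1 by rewrite subr_ge0 invf_le1// ltW.
have : 0 <= e * (((x + 1) ^+ 2 - x) / x).
  by rewrite mulr_ge0 ?(ltW e0)// divr_ge0 ?(ltW x0)//; nra.
lra.
Qed.

Lemma gauss_ent_atE u s : 0 < s ->
  gauss_ent_at u s = s * gauss_ent (u / s) + (u + s) * ln s.
Proof.
move=> s0; rewrite /gauss_ent_at /gauss_ent.
by move: (Ein _) (expR _) => E e; field; rewrite gt_eqF.
Qed.

Lemma gauss_ent_at0 s : 0 < s -> gauss_ent_at 0 s = s * ln s + (1 - gamma) * s.
Proof.
by move=> s0; rewrite /gauss_ent_at mul0r Ein0 oppr0 expR0 -/gamma; ring.
Qed.

(** Scaling of [mul_ln_le_gauss_ent]; the correction - s ln s, which tends to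
0 with s, is the price of the failure of subharmonicity at small u. *)
Lemma mul_ln_le_gauss_ent_at u s : 0 <= u -> 0 < s ->
  u * ln u <= gauss_ent_at u s - s * ln s.
Proof.
move=> u0 s0; rewrite gauss_ent_atE//.
have : s * (u / s * ln (u / s)) <= s * gauss_ent (u / s).
  by rewrite ler_wpM2l ?(ltW s0)// mul_ln_le_gauss_ent// divr_ge0// ltW.
have -> : s * (u / s * ln (u / s)) = u * ln u - u * ln s.
  rewrite mulrA [s * _]mulrC divfK ?gt_eqF//.
  move: u0; rewrite le_eqVlt => /predU1P[<-|u0]; first by rewrite !mul0r subrr.
  by rewrite ln_div ?posrE// mulrBr.
lra.
Qed.

(** The variance s is the time of a heat flow whose generator on radial
functions is f |-> (u f')', so this derivative is the Gaussian mean of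
ln u + 2.  As the logarithm is a fundamental solution, the derivative in s of
the latter is pi times the Gaussian density at distance sqrt u. *)
Lemma is_derive_gauss_ent_at u s : 0 < s ->
  is_derive s 1 (gauss_ent_at u) (ln s + Ein (u / s) + 2 - gamma).
Proof.
move=> s0; have sn0 : s != 0 by rewrite gt_eqF.
have hE : is_derive s 1 (fun s => Ein (u / s)) (dEin (u / s) * (u * - (s ^+ 2)^-1)).
  apply: is_derive_compE; first exact: is_derive_Ein.
  by derive_to; rewrite /=; ring.
have h := mul_dEin (u / s).
have hd : dEin (u / s) * (u * - (s ^+ 2)^-1) = - (1 - expR (- (u / s))) / s.
  by rewrite -h; field.
rewrite hd in hE.
by derive_to => //=; rewrite -/gamma; field.
Qed.

Lemma is_derive_gauss_ent_at2 u s : 0 < s ->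
  is_derive s 1 (fun s => ln s + Ein (u / s) + 2 - gamma) (expR (- (u / s)) / s).
Proof.
move=> s0; have sn0 : s != 0 by rewrite gt_eqF.
have hE : is_derive s 1 (fun s => Ein (u / s)) (dEin (u / s) * (u * - (s ^+ 2)^-1)).
  apply: is_derive_compE; first exact: is_derive_Ein.
  by derive_to; rewrite /=; ring.
have h := mul_dEin (u / s).
have hd : dEin (u / s) * (u * - (s ^+ 2)^-1) = - (1 - expR (- (u / s))) / s.
  by rewrite -h; field.
rewrite hd in hE.
by derive_to => //=; field.
Qed.

End EntropyFunctions.

(** * Iterated incomplete gamma integrals *)

Section IncompleteGamma.
Context {R : realType}.
Implicit Types r : R.

(** [inc_gamma j r] is the integral of t^j exp (-t) over [0, r], by the
recursion that integration by parts gives. *)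
Fixpoint inc_gamma (j : nat) r : R :=
  if j is i.+1 then i.+1%:R * inc_gamma i r - r ^+ i.+1 * expR (- r)
  else 1 - expR (- r).

(** The primitive of [inc_gamma j] that vanishes at 0, that is, the integral
of (r - t) t^j exp (-t) over [0, r]. *)
Fixpoint inc_gamma2 (j : nat) r : R :=
  if j is i.+1 then i.+1%:R * inc_gamma2 i r - inc_gamma i.+1 r
  else r - inc_gamma 0 r.

Lemma is_derive_inc_gamma (j : nat) r :
  is_derive r 1 (inc_gamma j) (r ^+ j * expR (- r)).
Proof.
elim: j => [|j ih] /=; first by derive_to; rewrite /= expr0; ring.
derive_to; rewrite /=; rewrite exprS; ring.
Qed.

Lemma is_derive_inc_gamma2 (j : nat) r :
  is_derive r 1 (inc_gamma2 j) (inc_gamma j r).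
Proof.
elim: j => [|j ih] /=.
  have h := is_derive_inc_gamma 0 r; rewrite /= in h.
  by derive_to; rewrite /= ; ring.
have h := is_derive_inc_gamma j.+1 r; rewrite /= in h.
derive_to; rewrite /=; rewrite exprS; ring.
Qed.

Lemma inc_gamma0 j : inc_gamma j 0 = 0.
Proof.
by elim: j => [|j ih] /=; rewrite ?ih ?oppr0 ?expR0 ?subrr// exprS !mul0r mulr0 subr0.
Qed.

Lemma inc_gamma20 j : inc_gamma2 j 0 = 0.
Proof.
elim: j => [|j ih] /=; first by rewrite oppr0 expR0 !subrr.
by rewrite ih inc_gamma0 !mulr0 exprS !mul0r !subrr.
Qed.

(** exp (y) f (y) increases. *)
Lemma ge0_of_derive_add_ge0 (f f' : R -> R) r : 0 <= r -> 0 <= f 0 ->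
  (forall y : R, 0 <= y -> is_derive y 1 f (f' y)) ->
  (forall y : R, 0 < y -> 0 <= f' y + f y) -> 0 <= f r.
Proof.
move=> r0 f0 fd ff; rewrite -(pmulr_rge0 _ (expR_gt0 r)).
apply: (le_trans f0); rewrite -[leLHS]mul1r -expR0.
pose F y := expR y * f y; pose dF y := expR y * (f' y + f y).
apply: (@le_of_derive_ge0 _ F dF _ _ r0) => y /andP[y0 _].
  by have h := fd y y0; derive_to; rewrite /= /dF; ring.
by rewrite mulr_ge0 ?expR_ge0// ff.
Qed.

(** With t = r x, the left side is r^(j+2) times the integral of
(1 - x) x^j exp (-r x) over [0, 1].  Since (1 - x)_+ <= exp (-x), this is at
most the integral of x^j exp (-(1 + r) x) over the half-line, which is
j! / (1 + r)^(j+1).  In place of integrals, the proof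
uses the relation P' + P = (j+1) Q between the left sides P for j+1 and Q for
j; the right sides satisfy it with >= in place of equality. *)
Lemma inc_gamma2_le (j : nat) r : 0 <= r ->
  inc_gamma2 j r <= j`!%:R * r ^+ j.+2 / (1 + r) ^+ j.+1.
Proof.
have dZ (i : nat) (y : R) : 0 <= y ->
    is_derive y 1 (fun y : R => i`!%:R * y ^+ i.+2 / (1 + y) ^+ i.+1)
      (i`!%:R * y ^+ i.+1 * (i%:R + 2 + y) / (1 + y) ^+ i.+2).
  move=> y0; have y1 : 1 + y != 0 by rewrite gt_eqF// ltr_wpDr.
  derive_to => /=; last by rewrite expf_neq0.
  rewrite !exprS ?expr0 -[i.+2%:R]natr1 -[i.+1%:R]natr1.
  have : (1 + y) ^+ i != 0 by rewrite expf_neq0.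
  move: (i`!%:R) ((1 + y) ^+ i) (y ^+ i) => a b c bn0.
  by field; rewrite bn0 y1.
elim: j r => [|j ih] r r0; rewrite -subr_ge0.
  apply: (@ge0_of_derive_add_ge0
    (fun y => 0`!%:R * y ^+ 2 / (1 + y) ^+ 1 - inc_gamma2 0 y)
    (fun y => 0`!%:R * y ^+ 1 * (0%:R + 2 + y) / (1 + y) ^+ 2 - inc_gamma 0 y) r r0).
  - by rewrite inc_gamma20 exprS !mul0r mulr0 mul0r subr0.
  - move=> y y0; have h1 := dZ 0 y y0; have h2 := is_derive_inc_gamma2 0 y.
    exact: (is_derive_addE h1 (is_derive_oppE h2)).
  - move=> y y0 /=.
    have -> : 0`!%:R * y ^+ 1 * (0 + 2 + y) / (1 + y) ^+ 2 - (1 - expR (- y)) +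
      (0`!%:R * y ^+ 2 / (1 + y) ^+ 1 - (y - (1 - expR (- y)))) =
      y / (1 + y) ^+ 2.
      by rewrite fact0; field; rewrite gt_eqF// ltr_wpDr// ltW.
    by rewrite divr_ge0 ?exprn_ge0// ltW// ltr_wpDr// ltW.
apply: (@ge0_of_derive_add_ge0
  (fun y => j.+1`!%:R * y ^+ j.+3 / (1 + y) ^+ j.+2 - inc_gamma2 j.+1 y)
  (fun y => j.+1`!%:R * y ^+ j.+2 * (j.+1%:R + 2 + y) / (1 + y) ^+ j.+3
            - inc_gamma j.+1 y) r r0).
- by rewrite inc_gamma20 exprS !mul0r mulr0 mul0r subr0.
- move=> y y0; have h1 := dZ j.+1 y y0; have h2 := is_derive_inc_gamma2 j.+1 y.
  exact: (is_derive_addE h1 (is_derive_oppE h2)).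
- move=> y y0.
  have y1 : 0 < 1 + y by rewrite ltr_wpDr// ltW.
  have : j.+1%:R * inc_gamma2 j y <=
      j.+1%:R * (j`!%:R * y ^+ j.+2 / (1 + y) ^+ j.+1).
    by apply: ler_wpM2l => //; apply: ih; exact: ltW.
  have : 0 <= j.+1`!%:R * y ^+ j.+2 * (j.+2%:R) / (1 + y) ^+ j.+3.
    apply: divr_ge0; last by apply/exprn_ge0/ltW.
    by do 2!apply: mulr_ge0 => //; apply/exprn_ge0/ltW.
  have : j.+1`!%:R * y ^+ j.+2 * (j.+1%:R + 2 + y) / (1 + y) ^+ j.+3 +
    j.+1`!%:R * y ^+ j.+3 / (1 + y) ^+ j.+2 -
    j.+1%:R * (j`!%:R * y ^+ j.+2 / (1 + y) ^+ j.+1) =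
    j.+1`!%:R * y ^+ j.+2 * (j.+2%:R) / (1 + y) ^+ j.+3.
    rewrite factS natrM !exprS -[j.+2%:R]natr1.
    have : (1 + y) ^+ j != 0 by rewrite expf_neq0// gt_eqF.
    move: (j`!%:R) ((1 + y) ^+ j) (y ^+ j) (j.+1%:R) => a b c d bn0.
    by field; rewrite bn0 gt_eqF.
  rewrite [inc_gamma2 j.+1 y]/= -/(inc_gamma j.+1 y).
  move: (inc_gamma _ y) (inc_gamma2 _ y) (_ / _) (_ / _) (_ / _) (_ / _) => a b c d e f.
  lra.
Qed.

End IncompleteGamma.

(** * Taylor polynomials of the Gaussian entropy *)

Section EntropyPolynomials.
Context {R : realType}.
Implicit Types (u s x y r : R).
Let gamma : R := euler_gamma R.

(** The Taylor coefficients of [gauss_ent] at 0. *)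
Definition ent_coef (n : nat) : R :=
  match n with
  | 0%N => 1 - euler_gamma R
  | 1%N => 2 - euler_gamma R
  | m.+2 => (-1) ^+ m / (m.+2`!%:R * (m.+2%:R * m.+1%:R))
  end.

Arguments ent_coef : simpl never.

(** Applying f |-> (x f')' twice to [gauss_ent] gives exp (-x). *)
Lemma ent_coefS2 (m : nat) :
  ent_coef m.+2 * (m.+2%:R * m.+1%:R) ^+ 2 = (-1) ^+ m / m`!%:R.
Proof.
rewrite /ent_coef !factS !natrM.
have : m`!%:R != 0 :> R by rewrite pnatr_eq0 -lt0n fact_gt0.
have : m.+2%:R != 0 :> R by rewrite pnatr_eq0.
have : m.+1%:R != 0 :> R by rewrite pnatr_eq0.
by move: (m.+1%:R) (m.+2%:R) (m`!%:R) ((-1) ^+ m) => a b c d a0 b0 c0;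
  field; rewrite a0 b0 c0.
Qed.

(** [ent_poly K] has degree K + 1, and [ent_poly1 K] of degree K is its image
under f |-> (x f')'. *)
Definition ent_poly (K : nat) x : R := \sum_(n < K.+2) ent_coef n * x ^+ n.
Definition ent_poly1 (K : nat) x : R :=
  \sum_(n < K.+1) ent_coef n.+1 * n.+1%:R ^+ 2 * x ^+ n.

(** Ein x + 2 - gamma is the image of [gauss_ent] under f |-> (x f')', and x
times its derivative is 1 - exp (-x): the sign comes from [series_exp_alt]. *)
Lemma ent_poly1_alt (K : nat) x : 0 <= x ->
  0 <= (-1) ^+ K * (Ein x + 2 - gamma - ent_poly1 K x).
Proof.
move=> x0.
pose f y := (-1) ^+ K * (Ein y + 2 - gamma - ent_poly1 K y).
pose dp y := \sum_(n < K.+1) ent_coef n.+1 * n.+1%:R ^+ 2 * (n%:R * y ^+ n.-1 * 1).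
pose df y := (-1) ^+ K * (dEin y - dp y).
have f0 : f 0 = 0.
  rewrite /f Ein0 /ent_poly1 big_ord_recl big1 /= => [|i _].
    by rewrite expr1n expr0 /ent_coef -/gamma; ring.
  by rewrite [0 ^+ _]expr0n mulr0.
rewrite -/(f x) -f0; apply: (@le_of_derive_ge0 _ f df _ _ x0) => y /andP[y0 _].
  have hE := is_derive_Ein y.
  have hp : is_derive y 1 (ent_poly1 K) (dp y).
    rewrite /ent_poly1 /dp; apply: is_derive_sumE => i _.
    by derive_to; rewrite /=; ring.
  by derive_to; rewrite /= /df; ring.
rewrite -(pmulr_rge0 _ y0) /df mulrCA mulrBr mul_dEin.
have -> : y * dp y = 1 - series (exp_coeff (- y)) K.+1.
  rewrite /dp /series/= [in RHS]big_nat_recl// [in LHS]big_ord_recl/=.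
  rewrite mul0r mul0r mulr0 mulrDr mulr0 add0r.
  rewrite {1}/exp_coeff/= expr0 fact0 divr1 opprD addrA subrr add0r.
  rewrite big_mkord -sumrN mulr_sumr; apply: eq_bigr => i _.
  rewrite /bump leq0n add1n /exp_coeff/=.
  transitivity (- ((ent_coef i.+2 * (i.+2%:R * i.+1%:R) ^+ 2) * (- y * y ^+ i) / i.+1%:R)).
    have : i.+1%:R != 0 :> R by rewrite pnatr_eq0.
    by move: (i.+1%:R) => a an0; field.
  by rewrite ent_coefS2 factS natrM invfM [in RHS]exprS [in RHS]exprNn; ring.
rewrite (_ : 1 - _ - _ = series (exp_coeff (- y)) K.+1 - expR (- y)); last by ring.
exact/series_exp_alt/ltW.
Qed.

(** Taylor polynomials of odd degree lie below [gauss_ent], those of even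
degree above.  Two integrations reduce this to [ent_poly1_alt]. *)
Lemma ent_poly_alt (K : nat) x : 0 <= x ->
  0 <= (-1) ^+ K * (gauss_ent x - ent_poly K x).
Proof.
move=> x0.
pose f y := (-1) ^+ K * (gauss_ent y - ent_poly K y).
pose dp y := \sum_(n < K.+2) ent_coef n * (n%:R * y ^+ n.-1).
pose df y := (-1) ^+ K * (Ein y + dEin y + 1 - gamma - dp y).
have f0 : f 0 = 0.
  rewrite /f /gauss_ent Ein0 oppr0 expR0 /ent_poly big_ord_recl big1 /= => [|i _].
    by rewrite expr0 /ent_coef -/gamma; ring.
  by rewrite [0 ^+ _]expr0n mulr0.
rewrite -/(f x) -f0; apply: (@le_of_derive_ge0 _ f df _ _ x0) => y /andP[y0 _].
  have hE := is_derive_gauss_ent y.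
  have hp : is_derive y 1 (ent_poly K) (dp y).
    rewrite /ent_poly /dp; apply: is_derive_sumE => i _.
    by derive_to; rewrite /=; ring.
  by derive_to; rewrite /= /df -/gamma; ring.
rewrite -(pmulr_rge0 _ y0).
(* The derivative [df] has the sign of [w], whose derivative is known. *)
pose w z := z * df z; pose dw z := (-1) ^+ K * (Ein z + 2 - gamma - ent_poly1 K z).
have w0 : w 0 = 0 by rewrite /w mul0r.
rewrite -/(w y) -w0; apply: (@le_of_derive_ge0 _ w dw _ _ (ltW y0)) => z /andP[z0 _].
  have -> : w = (fun z => (-1) ^+ K * (z * (Ein z + dEin z + 1 - gamma) -
      \sum_(n < K.+2) ent_coef n * n%:R * z ^+ n)).
    apply/funext => t; rewrite /w /df mulrCA mulrBr; congr (_ * (_ - _)).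
    rewrite /dp mulr_sumr; apply: eq_bigr => -[[|n] ?] _ /=.
      by rewrite !(mul0r, mulr0).
    by rewrite exprS; ring.
  have hE := is_derive_gauss_ent2 z.
  have hp : is_derive z 1 (fun z => \sum_(n < K.+2) ent_coef n * n%:R * z ^+ n)
     (\sum_(n < K.+2) ent_coef n * n%:R * (n%:R * z ^+ n.-1)).
    apply: is_derive_sumE => i _.
    by derive_to; rewrite /=; ring.
  derive_to; rewrite /= /dw -/gamma mul0r add0r; congr (_ * (_ - _)).
  rewrite big_ord_recl/= mulr0 mul0r add0r /ent_poly1.
  by apply: eq_bigr => i _; rewrite /bump/= add1n expr2 !mulrA.
exact/ent_poly1_alt/ltW.
Qed.

End EntropyPolynomials.

Arguments ent_coef : simpl never.

(** * Even moments of a shifted circle *)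

Section CircleMoments.
Context {R : realType}.
Implicit Types (u r x : R).

(** The mean of |v + a e|^(2n) over |e| = 1 when |v|^2 = u and |a|^2 = r:
expand (v + a e)^n and apply Parseval's identity. *)
Definition circle_moment (n : nat) u r : R :=
  \sum_(k < n.+1) 'C(n, k)%:R ^+ 2 * u ^+ (n - k) * r ^+ k.

Lemma fact_neq0 n : n`!%:R != 0 :> R.
Proof. by rewrite pnatr_eq0 -lt0n fact_gt0. Qed.

Lemma sum_nat_ge_shift (a K : nat) (F : nat -> R) :
  \sum_(0 <= m < K | (a <= m)%N) F m = \sum_(0 <= m < K - a) F (m + a)%N.
Proof.
by rewrite -(big_addn 0 K a xpredT F) add0n [RHS](big_nat_widenl a 0).
Qed.

Lemma exprDn_fact (M : nat) u r : (u + r) ^+ M / M`!%:R =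
  \sum_(j < M.+1) (u ^+ (M - j) / (M - j)`!%:R) * (r ^+ j / j`!%:R).
Proof.
rewrite exprDn mulr_suml; apply: eq_bigr => j _.
have jM : (j <= M)%N by rewrite -ltnS.
rewrite -(bin_fact jM) !natrM -mulr_natr.
have := fact_neq0 j; have := fact_neq0 (M - j).
have : 'C(M, j)%:R != 0 :> R by rewrite pnatr_eq0 -lt0n bin_gt0.
move: ('C(M, j)%:R) (j`!%:R) ((M - j)`!%:R) => a b c a0 b0 c0.
by field; rewrite a0 b0 c0.
Qed.

Lemma Vandermonde_diag (k l n : nat) : (k < n)%N ->
  'C(k + l, k) = \sum_(i < n) 'C(k, i) * 'C(l, i).
Proof.
move=> kn; rewrite -(subnKC kn) big_split_ord/= [X in _ = (_ + X)%N]big1 ?addn0.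
  rewrite -(binomial.Vandermonde k l k) (reindex_inj rev_ord_inj)/=.
  apply: eq_bigr => i _; rewrite subSS bin_sub -1?ltnS// subKn// -ltnS.
  by [].
by move=> i _; rewrite (@bin_small k)// ?mul0n// ltnS leq_addr.
Qed.

(** The same mean computed in another way: |v + a e|^2 is the sum of u + r and
of a term 2 Re (conj(v) a e), whose 2i-th moment is binomial (2i, i) (u r)^i
and whose odd moments vanish.  That both expansions agree is Vandermonde's
identity. *)
Lemma circle_momentE (n : nat) u r : circle_moment n u r / n`!%:R =
  \sum_(0 <= i < n.+1 | (i.*2 <= n)%N)
    (u * r) ^+ i / i`!%:R ^+ 2 * ((u + r) ^+ (n - i.*2) / (n - i.*2)`!%:R).
Proof.
(* Vandermonde's identity splits one factor binomial (n, k) of each term of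
   the left side into multinomial terms, which the right side groups by [i]. *)
pose F (i k : nat) : R := if (i <= k)%N && (k + i <= n)%N then
  u ^+ (n - k) * r ^+ k / (i`!%:R ^+ 2 * (k - i)`!%:R * (n - k - i)`!%:R) else 0.
transitivity (\sum_(k < n.+1) \sum_(i < n.+1) F i k).
  rewrite /circle_moment mulr_suml; apply: eq_bigr => k _.
  have kn : (k <= n)%N by rewrite -ltnS.
  have := @Vandermonde_diag k (n - k) n.+1 (ltn_ord k).
  rewrite subnKC// => Vk.
  rewrite expr2 {1}Vk -(bin_fact kn) !natrM natr_sum.
  have C0 : 'C(n, k)%:R != 0 :> R by rewrite pnatr_eq0 -lt0n bin_gt0.
  rewrite !mulr_suml; apply: eq_bigr => i _.
  rewrite natrM /F; case: ifPn => [/andP[ik kin]|].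
    have ink : (i <= n - k)%N by rewrite leq_subRL// addnC addnC.
    rewrite -(bin_fact ik) -(bin_fact ink) !natrM.
    have := fact_neq0 i; have := fact_neq0 (k - i); have := fact_neq0 (n - k - i).
    have : 'C(k, i)%:R != 0 :> R by rewrite pnatr_eq0 -lt0n bin_gt0.
    have : 'C(n - k, i)%:R != 0 :> R by rewrite pnatr_eq0 -lt0n bin_gt0.
    move: C0; move: ('C(n, k)%:R) ('C(k, i)%:R) ('C(n - k, i)%:R) (i`!%:R)
      ((k - i)`!%:R) ((n - k - i)`!%:R) (u ^+ _) (r ^+ _).
    move=> a b c d e f x y a0 b0 c0 d0 e0 f0.
    by field; rewrite a0 b0 c0 d0 e0 f0.
  rewrite negb_and -!ltnNge => /orP[ki|nki].
    by rewrite (bin_small ki) !mul0r.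
  by rewrite (@bin_small (n - k)) ?mulr0 ?mul0r// ltn_subLR.
rewrite exchange_big/= [RHS]big_mkord [RHS]big_mkcond/=; apply: eq_bigr => i _.
case: ifPn => [i2n|]; last first.
  rewrite -ltnNge => ni2; apply: big1 => k _; rewrite /F ifF//.
  apply/negbTE/negP => /andP[ik kin].
  by move: ni2; rewrite ltnNge (leq_trans _ kin)// -addnn leq_add2r.
have iln : (i <= n)%N by rewrite (leq_trans _ i2n)// -addnn leq_addr.
rewrite exprDn_fact mulr_sumr.
transitivity (\sum_(0 <= k < (n - i).+1 | (i <= k)%N) F i k).
  rewrite [RHS](big_nat_widen _ _ n.+1) ?ltnS ?leq_subr//.
  rewrite [RHS]big_mkcond/= -(big_mkord xpredT (F i)); apply: eq_big_nat => k /andP[_ kn].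
  rewrite ltnS leq_subRL// [(i + k)%N]addnC /F.
  by case: ifP.
rewrite sum_nat_ge_shift subSn; last first.
  by rewrite leq_subRL// addnn.
rewrite -subnDA addnn big_mkord; apply: eq_bigr => j _.
have jn : (j <= n - i.*2)%N by rewrite -ltnS.
have jn' : (j + i + i <= n)%N by rewrite -addnA addnn addnC -leq_subRL.
rewrite /F leq_addl jn'/= addnK -!subnDA -addnA addnn -[(i.*2 + j)%N]addnC.
have sub_shift (a b c : nat) : (a + b + b <= c)%N ->
    (c - (a + b) = c - (a + b.*2) + b)%N.
  move=> abc; have abc' : (a + b <= c)%N by rewrite (leq_trans _ abc)// leq_addr.
  by rewrite -addnn addnA [in RHS]subnDA subnK// leq_subRL.
rewrite (sub_shift _ _ _ jn').
rewrite !exprD exprMn.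
have := fact_neq0 i; have := fact_neq0 j; have := fact_neq0 (n - (j + i.*2)).
move: (i`!%:R) (j`!%:R) ((n - (j + i.*2))`!%:R).
move=> a b c a0 b0 c0.
by field; rewrite a0 b0 c0.
Qed.

(** The circle mean of a Taylor polynomial of exp (-x) at |v + a e|^2.
Grouping by i gives a truncation of exp (- u - r) times the Bessel series
of the mean of exp (-2 Re (conj(v) a e)). *)
Lemma alternating_circle_moments (K : nat) u r :
  \sum_(0 <= m < K) (-1) ^+ m / m`!%:R * circle_moment m u r =
  \sum_(0 <= i < K | (i.*2 < K)%N)
    (u * r) ^+ i / i`!%:R ^+ 2 * series (exp_coeff (- (u + r))) (K - i.*2)%N.
Proof.
pose F (i m : nat) : R := if (i.*2 <= m)%N then
  (u * r) ^+ i / i`!%:R ^+ 2 *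
   ((- (u + r)) ^+ (m - i.*2) / (m - i.*2)`!%:R) else 0.
transitivity (\sum_(0 <= m < K) \sum_(0 <= i < K) F i m).
  apply: eq_big_nat => m /andP[_ mK].
  rewrite -mulrA [_^-1 * _]mulrC circle_momentE mulr_sumr.
  rewrite (big_nat_widen 0 m.+1 K)//= [LHS]big_mkcond/=; apply: eq_bigr => i _.
  rewrite /F; case: ifPn => [/andP[im _]|]; last first.
    case: ifPn => //= i2m; rewrite ltnS -ltnNge => mi.
    by have := leq_ltn_trans i2m mi; rewrite -addnn -[X in (_ < X)%N]addn0 ltn_add2l.
  rewrite im [(- (u + r)) ^+ _]exprNn mulrCA -[X in _ = _ * X]mulrA.
  congr (_ * (_ * _)).
  by rewrite -{1}(subnK im) exprD -[(-1) ^+ i.*2]signr_odd odd_double expr0 mulr1.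
rewrite exchange_big/= [RHS]big_mkcond/=; apply: eq_bigr => i _.
rewrite -big_mkcond/= sum_nat_ge_shift -mulr_sumr.
case: ifPn => [i2K|]; last first.
  by rewrite -leqNgt => Ki; rewrite (eqP Ki) big_geq ?mulr0.
congr (_ * _); rewrite /series/=; apply: eq_bigr => m _.
by rewrite addnK.
Qed.

(** For an even number of terms, every factor that truncates exp (- u - r)
is of odd degree, hence a lower bound. *)
Lemma alternating_circle_moments_le (J : nat) u r : 0 <= u -> 0 <= r ->
  \sum_(0 <= m < J.*2) (-1) ^+ m / m`!%:R * circle_moment m u r <=
  expR (- (u + r)) * \sum_(0 <= i < J) (u * r) ^+ i / i`!%:R ^+ 2.
Proof.
move=> u0 r0; rewrite alternating_circle_moments.
under eq_bigl do rewrite ltn_double.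
have -> : \sum_(0 <= i < J) (u * r) ^+ i / i`!%:R ^+ 2 =
    \sum_(0 <= i < J.*2 | (i < J)%N) (u * r) ^+ i / i`!%:R ^+ 2.
  by rewrite (big_nat_widen 0 J J.*2)// -addnn leq_addr.
rewrite mulr_sumr; apply: ler_sum => i iJ; rewrite mulrC ler_wpM2r//.
  by rewrite mulr_ge0 ?invr_ge0 ?exprn_ge0// mulr_ge0.
rewrite -doubleB -(prednK (n := J - i)) ?subn_gt0// doubleS.
have := @series_exp_alt R (J - i).-1.*2.+1 (u + r) (addr_ge0 u0 r0).
by rewrite exprS -signr_odd odd_double mulr1 mulN1r oppr_ge0 subr_le0.
Qed.

End CircleMoments.

(** * One rotation compared with one Gaussian variable *)

Section CirclePolynomials.
Context {R : realType}.
Implicit Types (u r x : R).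

Definition circle_poly u (n : nat) : {poly R} :=
  \poly_(k < n.+1) ('C(n, k)%:R ^+ 2 * u ^+ (n - k)).

Lemma horner_circle_poly u n r : (circle_poly u n).[r] = circle_moment n u r.
Proof. by rewrite horner_poly. Qed.

(** The mean of [ent_poly K] at |v + a e|^2 over |e| = 1, with |v|^2 = u, as a
polynomial in r = |a|^2. *)
Definition ent_circle_poly u (K : nat) : {poly R} :=
  \sum_(n < K.+2) ent_coef n *: circle_poly u n.

(** (r^2 f'')'' is the square of the operator f |-> (r f')': on the monomial
r^k both are multiplication by k^2 (k-1)^2, followed by a shift by 2. *)
Lemma coef_deriv_X2_deriv (p : {poly R}) i :
  ('X^2 * p^`(2))^`(2)`_i = p`_i.+2 * (i.+2%:R * i.+1%:R) ^+ 2.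
Proof.
have coefX2 (q : {poly R}) : ('X^2 * q)`_(2 + i) = q`_i.
  by rewrite coefXnM addKn ltnNge leq_addr.
rewrite coef_derivn coefX2 coef_derivn.
rewrite [(2 + i)%N]addnC addn2 !ffactnS !ffactn0 muln1/=.
by rewrite -mulrnA -[LHS]mulr_natr !natrM expr2.
Qed.

(** The Laplacian in a commutes with the circle mean, so its square acts on
the entropy polynomial and leaves a Taylor polynomial of exp (-x). *)
Lemma deriv_ent_circle_poly u K : ('X^2 * (ent_circle_poly u K)^`(2))^`(2) =
  \sum_(0 <= m < K) ((-1) ^+ m / m`!%:R) *: circle_poly u m.
Proof.
apply/polyP => i; rewrite coef_deriv_X2_deriv /ent_circle_poly !coef_sum.
rewrite big_ord_recl big_ord_recl/= !coefZ !coef_poly/= !mulr0 !add0r.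
rewrite big_mkord mulr_suml; apply: eq_bigr => m _.
rewrite !coefZ !coef_poly /bump leq0n !add1n !ltnS -ent_coefS2.
case: ifP => im; last by rewrite !mulr0 mul0r.
rewrite !subSS.
have /(congr1 (fun n => n%:R : R)) := mul_bin_diag m.+2 i.+1.
have /(congr1 (fun n => n%:R : R)) := mul_bin_diag m.+1 i.
rewrite /= !natrM => h1 h2.
transitivity (ent_coef m.+2 * u ^+ (m - i) *
    (i.+1%:R * (i.+2%:R * 'C(m.+2, i.+2)%:R)) ^+ 2); first by ring.
rewrite -h2 [_ * (m.+2%:R * _)]mulrCA -h1; ring.
Qed.

Lemma deriv_ent_circle_poly_le u (J : nat) r : 0 <= u -> 0 <= r ->
  ('X^2 * (ent_circle_poly u J.*2)^`(2))^`(2).[r] <=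
  expR (- u) * \sum_(0 <= i < J) u ^+ i / i`!%:R ^+ 2 * (r ^+ i * expR (- r)).
Proof.
move=> u0 r0; rewrite deriv_ent_circle_poly horner_sum.
under eq_bigr do rewrite hornerZ horner_circle_poly.
apply: (le_trans (alternating_circle_moments_le J u0 r0)).
rewrite opprD expRD -mulrA ler_wpM2l ?expR_ge0// mulr_sumr.
by apply: ler_sum => i _; rewrite exprMn le_eqVlt; apply/orP; left; apply/eqP; ring.
Qed.

(** Let b be the polynomial on the left.  The function r^2 b'' vanishes at 0
together with its derivative, and its second derivative is at most
exp (-u) sum_i u^i / i!^2 r^i exp (-r).  Two integrations produce [inc_gamma2],
and the bound [inc_gamma2_le] turns the sum over i into a partial sum of
exp (u r / (1 + r)).  The right side is the second derivative of
[gauss_ent_at u] at 1 + r. *)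
Lemma second_deriv_ent_circle_poly_le u (J : nat) r : 0 <= u -> 0 < r ->
  (ent_circle_poly u J.*2)^`(2).[r] <= expR (- (u / (1 + r))) / (1 + r).
Proof.
move=> u0 r0; have r1 : 0 < 1 + r by rewrite ltr_wpDr// ltW.
rewrite -(ler_pM2l (exprn_gt0 2 r0)).
set P := 'X^2 * (ent_circle_poly u J.*2)^`(2).
have PE : P.[r] = r ^+ 2 * (ent_circle_poly u J.*2)^`(2).[r].
  by rewrite /P hornerM hornerXn.
rewrite -PE.
(* [H] carries the weights of the sum, for integrating it term by term. *)
pose H (j : nat -> R) := expR (- u) * \sum_(0 <= i < J) u ^+ i / i`!%:R ^+ 2 * j i.
have dH (f df : nat -> R -> R) (y : R) :
    (forall i, is_derive y 1 (f i) (df i y)) ->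
    is_derive y 1 (fun y => H (fun i => f i y)) (H (fun i => df i y)).
  move=> fd; rewrite /H.
  have hs : is_derive y 1
      (fun y => \sum_(0 <= i < J) u ^+ i / i`!%:R ^+ 2 * f i y)
      (\sum_(0 <= i < J) u ^+ i / i`!%:R ^+ 2 * df i y).
    by apply: is_derive_sumE => i _; have h := fd i; derive_to; rewrite /=; ring.
  by derive_to; rewrite /=; ring.
have P1 y : 0 <= y -> P^`().[y] <= H (fun i => inc_gamma i y).
  move=> y0; rewrite -subr_ge0.
  have <- : H (fun i => inc_gamma i 0) - P^`().[0] = 0.
    rewrite /H big1 => [|i _]; last by rewrite inc_gamma0 mulr0.
    rewrite mulr0 sub0r /P derivM derivXn hornerD !hornerM hornerMn !hornerE.
    by rewrite mul0rn mul0r oppr0.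
  apply: (@le_of_derive_ge0 _ (fun y => H (fun i => inc_gamma i y) - P^`().[y])
    (fun y => H (fun i => y ^+ i * expR (- y)) - P^`()^`().[y]) _ _ y0) => z /andP[z0 zy].
    apply: is_derive_addE; first exact: (dH (@inc_gamma R) (fun i y => y ^+ i * expR (- y))
      z (fun i => is_derive_inc_gamma i z)).
  rewrite subr_ge0; apply: (le_trans _ (deriv_ent_circle_poly_le J u0 (ltW z0))).
  by rewrite derivSn.
have P2 : P.[r] <= H (fun i => inc_gamma2 i r).
  rewrite -subr_ge0.
  have <- : H (fun i => inc_gamma2 i 0) - P.[0] = 0.
    rewrite /H big1 => [|i _]; last by rewrite inc_gamma20 mulr0.
    by rewrite mulr0 sub0r /P hornerM hornerXn expr0n mul0r oppr0.
  apply: (@le_of_derive_ge0 _ (fun y => H (fun i => inc_gamma2 i y) - P.[y])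
    (fun y => H (fun i => inc_gamma i y) - P^`().[y]) _ _ (ltW r0)) => z /andP[z0 zr].
    apply: is_derive_addE; first exact: (dH (@inc_gamma2 R) (@inc_gamma R)
      z (fun i => is_derive_inc_gamma2 i z)).
  by rewrite subr_ge0 P1// ltW.
apply: (le_trans P2); rewrite /H.
have -> : - (u / (1 + r)) = - u + u * r / (1 + r) by field; rewrite gt_eqF.
rewrite expRD mulrCA -!mulrA ler_wpM2l ?expR_ge0//.
have x0 : 0 <= u * (r / (1 + r)).
  by rewrite mulr_ge0// divr_ge0 ?ltW.
apply: (@le_trans _ _ (series (exp_coeff (u * (r / (1 + r)))) J * (r ^+ 2 / (1 + r)))).
  rewrite /series/= mulr_suml; apply: ler_sum => i _.
  apply: (@le_trans _ _ (u ^+ i / i`!%:R ^+ 2 *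
      (i`!%:R * r ^+ i.+2 / (1 + r) ^+ i.+1))).
    rewrite ler_wpM2l ?inc_gamma2_le ?(ltW r0)//.
    by rewrite divr_ge0 ?exprn_ge0.
  rewrite /exp_coeff/= !exprMn exprVn !exprS le_eqVlt; apply/orP; left; apply/eqP.
  have := @fact_neq0 R i; have := expf_neq0 i (lt0r_neq0 r1).
  move: (i`!%:R) ((1 + r) ^+ i) => a b b0 a0.
  by field; rewrite a0 b0 gt_eqF.
rewrite expr2 -[r * r / _]mulrA ler_wpM2r ?series_exp_le//.
by rewrite mulr_ge0 ?divr_ge0 ?ltW.
Qed.

(** At r = 0 the value and the first derivative of the left side are values at
u of the Taylor polynomials [ent_poly] and [ent_poly1], which are lower bounds
for those of the right side; the second derivatives are compared in
[second_deriv_ent_circle_poly_le]. *)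
Lemma ent_circle_poly_le u (J : nat) r : 0 <= u -> 0 <= r ->
  (ent_circle_poly u J.*2).[r] <= gauss_ent_at u (1 + r).
Proof.
move=> u0 r0; rewrite -subr_ge0.
set b := ent_circle_poly u J.*2.
have circ0 n : circle_moment n u 0 = u ^+ n.
  rewrite /circle_moment big_ord_recl big1 => [|i _].
    by rewrite bin0 expr1n subn0 expr0 addr0 mulr1 mul1r.
  by rewrite [0 ^+ _]expr0n mulr0.
pose k y := ln (1 + y) + Ein (u / (1 + y)) + 2 - euler_gamma R.
have sh (h : R -> R) (dh y : R) : is_derive (1 + y) 1 h dh ->
    is_derive y 1 (fun y => h (1 + y)) dh.
  move=> hd; rewrite -[dh]mulr1; apply: is_derive_compE hd _.
  by derive_to; rewrite /=; ring.
have b1 y : 0 <= y -> 0 <= k y - b^`().[y].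
  move=> y0; apply: (@le_trans _ _ (k 0 - b^`().[0])).
    have := @ent_poly1_alt R J.*2 u u0.
    rewrite -signr_odd odd_double mul1r; congr (0 <= _).
    rewrite /k addr0 ln1 add0r divr1; congr (_ - _).
    rewrite horner_coef0 coef_deriv mulr1n /b /ent_circle_poly coef_sum /ent_poly1.
    rewrite [RHS]big_ord_recl coefZ coef_poly/= mulr0 add0r; apply: eq_bigr => i _.
    by rewrite coefZ coef_poly /bump leq0n add1n /= bin1 subn1 [RHS]mulrA.
  apply: (@le_of_derive_ge0 _ (fun y => k y - b^`().[y])
    (fun y => expR (- (u / (1 + y))) / (1 + y) - b^`()^`().[y]) _ _ y0) => z.
    move=> /andP[z0 _]; have z1 : 0 < 1 + z by rewrite ltr_wpDr.
    apply: is_derive_addE.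
    exact: (sh (fun s => ln s + Ein (u / s) + 2 - euler_gamma R))
      (is_derive_gauss_ent_at2 u z1).
  move=> /andP[z0 _]; rewrite subr_ge0.
  exact: second_deriv_ent_circle_poly_le.
apply: (@le_trans _ _ (gauss_ent_at u (1 + 0) - b.[0])).
  rewrite addr0 gauss_ent_atE// ln1 mulr0 addr0 mul1r divr1.
  have := @ent_poly_alt R J.*2 u u0.
  rewrite -signr_odd odd_double mul1r; congr (0 <= _); congr (_ - _).
  rewrite /b /ent_circle_poly horner_sum; apply: eq_bigr => i _.
  by rewrite hornerZ horner_circle_poly circ0.
apply: (@le_of_derive_ge0 _ (fun y => gauss_ent_at u (1 + y) - b.[y])
  (fun y => k y - b^`().[y]) _ _ r0) => z /andP[z0 _].
  have z1 : 0 < 1 + z by rewrite ltr_wpDr.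
  apply: is_derive_addE.
  exact: sh (is_derive_gauss_ent_at u z1).
by apply: b1; exact: ltW.
Qed.

Lemma ent_coef_le (n : nat) : `|ent_coef n.+2| <= n.+2`!%:R^-1 :> R.
Proof.
rewrite /ent_coef normrM normrX normrN1 expr1n mul1r invfM normrM.
rewrite !ger0_norm ?invr_ge0 ?mulr_ge0//.
by rewrite ler_piMr ?invr_ge0// invf_le1 -natrM ?ltr0n ?ler1n.
Qed.

(** Add the next term of the Taylor series, which gives an upper bound. *)
Lemma gauss_ent_le_poly (J : nat) x : 0 <= x ->
  gauss_ent x <= ent_poly J.*2 x + x ^+ J.*2.+2 / J.*2.+2`!%:R.
Proof.
move=> x0; have := @ent_poly_alt R J.*2.+1 x x0.
rewrite exprS -signr_odd odd_double mulr1 mulN1r oppr_ge0 subr_le0.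
move=> /le_trans; apply; rewrite /ent_poly big_ord_recr/= lerD2l mulrC.
rewrite ler_wpM2l ?exprn_ge0//; apply: le_trans (ent_coef_le _).
exact: ler_norm.
Qed.

End CirclePolynomials.

(** * Averages over roots of unity *)

Section RootsOfUnity.
Context {R : realType}.
Notation C := R[i].
Implicit Types (z v a w : C) (F G : C -> R).

Lemma prim_root_exists (N : nat) : (0 < N)%N -> exists w, N.-primitive_root w.
Proof.
pose p : {poly C} := 'X^N - 1; have [r Dp] := closed_field_poly_normal p.
move=> N0; rewrite (monicP _) ?monicXnsubC // scale1r in Dp.
have rn1: all N.-unity_root r by apply/allP=> z; rewrite -root_prod_XsubC -Dp.
have sz_r: (N < (size r).+1)%N.
  by rewrite -(size_prod_XsubC r id) -Dp size_XnsubC.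
have [|z] := hasP (has_prim_root N0 rn1 _ sz_r); last by exists z.
by rewrite -separable_prod_XsubC -Dp separable_Xn_sub_1 // pnatr_eq0 -lt0n.
Qed.

Lemma sqr_normcE z : (normc z ^+ 2)%:C = z * z^*%C.
Proof. by rewrite -sqr_normc rmorphXn. Qed.

Lemma normcX z n : normc (z ^+ n) = normc z ^+ n.
Proof. by elim: n => [|n ih]; rewrite ?expr0 ?normc1// !exprS normcM ih. Qed.

Lemma normc_prim_root (N : nat) w : (0 < N)%N -> N.-primitive_root w -> normc w = 1.
Proof.
move=> N0 /prim_expr_order /(congr1 (@normc R)); rewrite normcX normc1 => /eqP.
by rewrite pexpr_eq1 ?normc_ge0// => /eqP.
Qed.

Lemma sum_prim_root (N k l : nat) w : N.-primitive_root w ->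
  (k < N)%N -> (l < N)%N ->
  \sum_(j < N) (w ^+ k / w ^+ l) ^+ j = if k == l then N%:R else 0.
Proof.
move=> wN kN lN; have N0 : (0 < N)%N by exact: leq_ltn_trans kN.
have w0 : w != 0.
  apply/eqP => w0; have := normc_prim_root N0 wN.
  by rewrite w0 normc0 => /eqP; rewrite eq_sym oner_eq0.
have wl0 : w ^+ l != 0 by rewrite expf_neq0.
case: eqVneq => [->|nkl].
  rewrite divff//; under eq_bigr do rewrite expr1n.
  by rewrite sumr_const card_ord.
have z1 : w ^+ k / w ^+ l != 1.
  apply/eqP => /(congr1 ( *%R^~ (w ^+ l))); rewrite divfK// mul1r => /eqP.
  by rewrite (eq_prim_root_expr wN) !modn_small// (negbTE nkl).
have /eqP := subrX1 (w ^+ k / w ^+ l) N.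
rewrite expr_div_n -!exprM ![(_ * N)%N]mulnC !exprM (prim_expr_order wN) !expr1n.
by rewrite divr1 subrr eq_sym mulf_eq0 subr_eq0 (negbTE z1) => /eqP.
Qed.

(** Below the degree N, the powers of the N-th roots of unity are orthogonal
for the average over these roots. *)
Lemma parseval (N n : nat) w (c : nat -> C) : N.-primitive_root w -> (n < N)%N ->
  \sum_(j < N) normc (\sum_(k < n.+1) c k * (w ^+ j) ^+ k) ^+ 2 =
  N%:R * \sum_(k < n.+1) normc (c k) ^+ 2.
Proof.
move=> wN nN; have N0 : (0 < N)%N by exact: leq_ltn_trans nN.
apply: (@complexI R); rewrite rmorphM !rmorph_sum/= rmorph_nat.
transitivity (\sum_(j < N) \sum_(k < n.+1) \sum_(l < n.+1)
    (c k * (c l)^*%C) * (w ^+ k / w ^+ l) ^+ j).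
  apply: eq_bigr => j _; rewrite sqr_normcE rmorph_sum/= mulr_suml.
  apply: eq_bigr => k _; rewrite mulr_sumr; apply: eq_bigr => l _.
  rewrite rmorphM/= !rmorphXn/=.
  have -> : w^*%C = w^-1.
    by rewrite invc_norm normC_normc (normc_prim_root N0 wN) expr1n invr1 mul1r.
  by rewrite expr_div_n !exprVn -!exprM ![(j * _)%N]mulnC; ring.
rewrite exchange_big/= mulr_sumr; apply: eq_bigr => k _.
rewrite exchange_big/= (bigD1 k)//= -mulr_sumr.
rewrite (sum_prim_root wN) ?(leq_trans (ltn_ord _) nN)// eqxx.
rewrite big1 ?addr0 => [|l lk]; first by rewrite sqr_normcE mulrC.
rewrite -mulr_sumr (sum_prim_root wN) ?(leq_trans (ltn_ord _) nN)//.
by rewrite ifN ?mulr0// eq_sym.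
Qed.

(** The mean of F over the N-th roots of unity when w is primitive. *)
Definition root_mean (N : nat) w F : R := N%:R^-1 * \sum_(j < N) F (w ^+ j).

Lemma root_mean_moment (N n : nat) w v a : N.-primitive_root w -> (n < N)%N ->
  root_mean N w (fun e => (normc (v + a * e) ^+ 2) ^+ n) =
  circle_moment n (normc v ^+ 2) (normc a ^+ 2).
Proof.
move=> wN nN; have N0 : (0 < N)%N by exact: leq_ltn_trans nN.
pose c k := 'C(n, k)%:R * (v ^+ (n - k) * a ^+ k).
have cE j : (normc (v + a * w ^+ j) ^+ 2) ^+ n =
    normc (\sum_(k < n.+1) c k * (w ^+ j) ^+ k) ^+ 2.
  rewrite -exprM mulnC exprM -normcX; congr (normc _ ^+ 2).
  rewrite exprDn; apply: eq_bigr => k _.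
  by rewrite exprMn -mulr_natl /c; ring.
rewrite /root_mean; under eq_bigr do rewrite cE.
rewrite (parseval _ wN nN) mulrA mulVf ?pnatr_eq0 -?lt0n// mul1r.
apply: eq_bigr => k _; rewrite /c !normcM !normcX.
have -> : normc ('C(n, k)%:R : C) = 'C(n, k)%:R :> R.
  by rewrite -(rmorph_nat (real_complex R)) /normc/= expr0n addr0 sqrtr_sqr ger0_norm.
by rewrite [LHS]exprMn [X in _ * X = _]exprMn mulrA -!exprM ![(2 * _)%N]mulnC.
Qed.

Section Mean.
Context (N : nat) (w : C).
Context (N0 : (0 < N)%N) (wN : N.-primitive_root w).
Let Nn0 : N%:R != 0 :> R. Proof. by rewrite pnatr_eq0 -lt0n. Qed.

Lemma ler_root_mean F G : (forall e, normc e = 1 -> F e <= G e) ->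
  root_mean N w F <= root_mean N w G.
Proof.
move=> FG; rewrite ler_wpM2l ?invr_ge0//; apply: ler_sum => j _; apply: FG.
by rewrite normcX (normc_prim_root N0 wN) expr1n.
Qed.

Lemma root_mean_cst (c : R) : root_mean N w (fun=> c) = c.
Proof.
by rewrite /root_mean sumr_const card_ord -[c *+ N]mulr_natl mulrA mulVf// mul1r.
Qed.

Lemma root_meanD F G : root_mean N w (fun e => F e + G e) =
  root_mean N w F + root_mean N w G.
Proof. by rewrite /root_mean big_split mulrDr. Qed.

Lemma root_meanZ (c : R) F : root_mean N w (fun e => c * F e) = c * root_mean N w F.
Proof. by rewrite /root_mean -mulr_sumr mulrCA. Qed.

Lemma root_mean_sum (I : Type) (r : seq I) (H : I -> C -> R) :
  root_mean N w (fun e => \sum_(i <- r) H i e) = \sum_(i <- r) root_mean N w (H i).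
Proof. by rewrite /root_mean exchange_big/= mulr_sumr. Qed.

Lemma root_mean_sqr v a : (1 < N)%N ->
  root_mean N w (fun e => normc (v + a * e) ^+ 2) = normc v ^+ 2 + normc a ^+ 2.
Proof.
move=> N1; have <- : circle_moment 1 (normc v ^+ 2) (normc a ^+ 2) = normc v ^+ 2 + normc a ^+ 2.
  rewrite /circle_moment !big_ord_recl big_ord0 /bump/= bin0 binn subnn subn0.
  by rewrite !expr0 !expr1 expr1n; ring.
rewrite -(root_mean_moment v a wN N1) /root_mean.
by under [in RHS]eq_bigr do rewrite expr1.
Qed.

End Mean.

End RootsOfUnity.

(** * Replacing rotations by Gaussian variance *)

Section EntropyStep.
Context {R : realType}.
Notation C := R[i].
Implicit Types (z v a w : C).

Lemma horner_ent_circle_poly (u r : R) K :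
  (ent_circle_poly u K).[r] = \sum_(n < K.+2) ent_coef n * circle_moment n u r.
Proof.
rewrite /ent_circle_poly horner_sum; apply: eq_bigr => i _.
by rewrite hornerZ horner_circle_poly.
Qed.

Lemma circle_momentZ (n : nat) (u r s : R) : s != 0 ->
  circle_moment n (u / s) (r / s) = circle_moment n u r / s ^+ n.
Proof.
move=> s0; rewrite /circle_moment mulr_suml; apply: eq_bigr => k _.
have kn : (k <= n)%N by rewrite -ltnS.
have -> : s ^+ n = s ^+ (n - k) * s ^+ k by rewrite -exprD subnK.
by rewrite !exprMn !exprVn invfM; ring.
Qed.

(** Rotating a by a random root of unity gives at most the entropy that the
same amount of Gaussian variance gives.  [gauss_ent_at] is replaced by its
Taylor polynomial, whose mean is the one over the circle, and
[ent_circle_poly_le] applies after scaling by s.  The quantity M bounds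
|v + a e|^2 / s and thereby the remainder. *)
Lemma root_mean_gauss_ent_le (N J : nat) w v a (s M : R) : N.-primitive_root w ->
  (J.*2.+1 < N)%N -> 0 < s -> (normc v + normc a) ^+ 2 <= M * s ->
  root_mean N w (fun e => gauss_ent_at (normc (v + a * e) ^+ 2) s) <=
  gauss_ent_at (normc v ^+ 2) (s + normc a ^+ 2) + s * (M ^+ J.*2.+2 / J.*2.+2`!%:R).
Proof.
move=> wN JN s0 MB; have N0 : (0 < N)%N by exact: leq_ltn_trans JN.
have sn0 : s != 0 by rewrite gt_eqF.
pose U e := normc (v + a * e) ^+ 2.
have U0 e : 0 <= U e by rewrite /U exprn_ge0// normc_ge0.
set eps := M ^+ _ / _.
have h1 : root_mean N w (fun e => gauss_ent_at (U e) s) <=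
    root_mean N w (fun e => s * (\sum_(n < J.*2.+2) ent_coef n / s ^+ n * U e ^+ n)
      + (s * eps + (ln s * U e + s * ln s))).
  apply: ler_root_mean => // e e1; rewrite gauss_ent_atE// addrA -mulrDr.
  rewrite [(U e + s) * _]mulrDl [U e * _]mulrC lerD2r ler_wpM2l ?(ltW s0)//.
  have us0 : 0 <= U e / s by rewrite divr_ge0// ltW.
  apply: (le_trans (gauss_ent_le_poly J us0)); apply: lerD.
    rewrite /ent_poly; apply: ler_sum => n _.
    by rewrite exprMn exprVn mulrA mulrAC.
  rewrite ler_wpM2r ?invr_ge0// lerXn2r ?nnegrE//.
    by apply: le_trans us0 _; rewrite ler_pdivrMr// (le_trans _ MB)// lerXn2r
      ?nnegrE ?addr_ge0 ?normc_ge0// (le_trans (ler_normcD _ _))// normcM e1 mulr1.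
  rewrite ler_pdivrMr// (le_trans _ MB)// lerXn2r ?nnegrE ?addr_ge0 ?normc_ge0//.
  by rewrite (le_trans (ler_normcD _ _))// normcM e1 mulr1.
apply: (le_trans h1).
rewrite root_meanD root_meanZ root_mean_sum root_meanD root_mean_cst//.
rewrite root_meanD root_meanZ root_mean_cst//.
rewrite (root_mean_sqr wN) ?(leq_trans _ JN)//.
have -> : \sum_(n < J.*2.+2) root_mean N w (fun e => ent_coef n / s ^+ n * U e ^+ n) =
    (ent_circle_poly (normc v ^+ 2 / s) J.*2).[normc a ^+ 2 / s].
  rewrite horner_ent_circle_poly; apply: eq_bigr => n _.
  rewrite root_meanZ (root_mean_moment _ _ wN) ?(leq_trans (ltn_ord n) JN)//.
  by rewrite circle_momentZ// -mulrA [_^-1 * _]mulrC.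
set u := normc v ^+ 2; set r := normc a ^+ 2.
have u0 : 0 <= u by rewrite exprn_ge0// normc_ge0.
have r0 : 0 <= r by rewrite exprn_ge0// normc_ge0.
have := @ent_circle_poly_le R (u / s) J (r / s)
  (divr_ge0 u0 (ltW s0)) (divr_ge0 r0 (ltW s0)).
have sr0 : 0 < s + r by rewrite ltr_wpDr.
have -> : 1 + r / s = (s + r) / s by field.
rewrite gauss_ent_atE ?divr_gt0// gauss_ent_atE//.
have -> : u / s / ((s + r) / s) = u / (s + r) by field; rewrite sn0 gt_eqF.
rewrite ln_div ?posrE// -(ler_pM2l s0).
have -> : s * ((s + r) / s * gauss_ent (u / (s + r)) +
   (u / s + (s + r) / s) * (ln (s + r) - ln s)) =
   (s + r) * gauss_ent (u / (s + r)) + (u + (s + r)) * (ln (s + r) - ln s).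
  by field.
rewrite addrC.
move: (gauss_ent _) (ln s) (ln (s + r)) (s * _.[_]) (s * eps) => A B D E F.
by rewrite [(u + (s + r)) * (D - B)]mulrBr; lra.
Qed.

(** The mean of F over lists of n independent N-th roots of unity. *)
Fixpoint torus_mean (N : nat) w (n : nat) (F : seq C -> R) : R :=
  if n is m.+1 then root_mean N w (fun e => torus_mean N w m (fun l => F (e :: l)))
  else F [::].

(** When l is a list of independent variables that are uniform on the circle,
or here on roots of unity, this is a Steinhaus sum. *)
Definition steinhaus_sum (n : nat) (a : nat -> C) (l : seq C) : C :=
  \sum_(i < n) a i * l`_i.

Lemma steinhaus_sum_cons n (a : nat -> C) e l :
  steinhaus_sum n.+1 a (e :: l) = a 0%N * e + steinhaus_sum n (a \o succn) l.
Proof. by rewrite /steinhaus_sum big_ord_recl. Qed.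

Section TorusMean.
Context (N : nat) (w : C).
Context (N0 : (0 < N)%N) (wN : N.-primitive_root w).

Lemma ler_torus_mean n (F G : seq C -> R) :
  (forall l, size l = n -> all (fun e => normc e == 1) l -> F l <= G l) ->
  torus_mean N w n F <= torus_mean N w n G.
Proof.
elim: n F G => [|n ih] F G FG /=; first exact: FG.
apply: ler_root_mean => // e e1; apply: ih => l ln l1.
by apply: FG; rewrite /= ?ln// e1 eqxx.
Qed.

Lemma torus_mean_cst n (c : R) : torus_mean N w n (fun=> c) = c.
Proof.
elim: n => //= n ih; rewrite -[RHS](root_mean_cst w N0).
by rewrite /root_mean; under eq_bigr do rewrite ih.
Qed.

Lemma torus_meanD n (F G : seq C -> R) : torus_mean N w n (fun l => F l + G l) =
  torus_mean N w n F + torus_mean N w n G.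
Proof.
elim: n F G => //= n ih F G; rewrite -root_meanD.
by rewrite /root_mean; under eq_bigr do rewrite ih.
Qed.

Lemma torus_meanZ n (c : R) (F : seq C -> R) :
  torus_mean N w n (fun l => c * F l) = c * torus_mean N w n F.
Proof.
elim: n F => //= n ih F; rewrite -root_meanZ.
by rewrite /root_mean; under eq_bigr do rewrite ih.
Qed.

Lemma torus_mean_sum n (I : Type) (r : seq I) (F : I -> seq C -> R) :
  torus_mean N w n (fun l => \sum_(i <- r) F i l) =
  \sum_(i <- r) torus_mean N w n (F i).
Proof.
elim: r => [|i r ih].
  under [in LHS]eq_fun do rewrite big_nil; rewrite big_nil; exact: torus_mean_cst.
under [in LHS]eq_fun do rewrite big_cons.
by rewrite torus_meanD big_cons ih.
Qed.

Lemma torus_mean_sqr n v (a : nat -> C) : (1 < N)%N ->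
  torus_mean N w n (fun l => normc (v + steinhaus_sum n a l) ^+ 2) =
  normc v ^+ 2 + \sum_(i < n) normc (a i) ^+ 2.
Proof.
move=> N1; elim: n v a => [|n ih] v a /=.
  by rewrite /steinhaus_sum !big_ord0 !addr0.
rewrite big_ord_recl addrA -(root_mean_sqr wN)//.
rewrite -[X in _ = _ + X](root_mean_cst w N0) -root_meanD.
rewrite /root_mean; congr (_ * _); apply: eq_bigr => j _.
by under eq_fun do rewrite steinhaus_sum_cons addrA; rewrite ih.
Qed.

(** Induction on n: for a fixed value e of the first variable, the hypothesis
applies to v + a_0 e in place of v and bounds the mean over the others by the
entropy of a Gaussian variable; [root_mean_gauss_ent_le] then averages
over e.  At n = 0 the smoothing by s > 0 makes [mul_ln_le_gauss_ent_at]
available.  The bounds B and S are uniform over the induction. *)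
Lemma torus_mean_ent_le (J n : nat) v (a : nat -> C) (s S M B : R) :
  (J.*2.+1 < N)%N -> 0 < s ->
  (forall i, (i < n)%N -> normc (a i) <= 1) ->
  normc v + n%:R <= B -> s + \sum_(i < n) normc (a i) ^+ 2 <= S ->
  (B ^+ 2 <= M * s) ->
  torus_mean N w n (fun l => normc (v + steinhaus_sum n a l) ^+ 2 *
                    ln (normc (v + steinhaus_sum n a l) ^+ 2)) <=
  gauss_ent_at (normc v ^+ 2) (s + \sum_(i < n) normc (a i) ^+ 2) - s * ln s +
  n%:R * (S * (M ^+ J.*2.+2 / J.*2.+2`!%:R)).
Proof.
move=> JN s0; elim: n v a => [|n ih] v a a1 vB sS MB /=.
  rewrite /steinhaus_sum !big_ord0 !addr0 mul0r addr0.
  by apply: mul_ln_le_gauss_ent_at => //; rewrite exprn_ge0// normc_ge0.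
set eps := M ^+ _ / _ in ih *.
have M0 : 0 <= M.
  by rewrite -(pmulr_lge0 _ s0) (le_trans _ MB)// sqr_ge0.
have eps0 : 0 <= eps by rewrite divr_ge0 ?exprn_ge0.
rewrite big_ord_recl/= in sS *.
set T := \sum_(i < n) _ in sS *.
have T0 : 0 <= T by apply: sumr_ge0 => i _; rewrite exprn_ge0// normc_ge0.
have a00 : 0 <= normc (a 0%N) ^+ 2 by rewrite exprn_ge0// normc_ge0.
have nv := normc_ge0 v; have na := normc_ge0 (a 0%N).
have a01 := a1 0%N (ltn0Sn _).
rewrite -natr1 in vB.
apply: (@le_trans _ _ (root_mean N w (fun e =>
   gauss_ent_at (normc (v + a 0%N * e) ^+ 2) (s + T) + (- (s * ln s) + n%:R * (S * eps))))).
  apply: ler_root_mean => // e e1; rewrite addrA.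
  under eq_fun do rewrite steinhaus_sum_cons addrA.
  apply: ih => //.
  - by move=> i il; exact: a1.
  - apply: (le_trans _ vB); rewrite [_ + 1]addrC addrA lerD2r.
    by rewrite (le_trans (ler_normcD _ _))// lerD2l normcM e1 mulr1.
  - by apply: (le_trans _ sS); rewrite lerD2l lerDr.
rewrite root_meanD root_mean_cst//.
have sT0 : 0 < s + T by rewrite ltr_wpDr.
have h : (normc v + normc (a 0%N)) ^+ 2 <= M * (s + T).
  have n0 : 0 <= n%:R :> R by [].
  apply: (@le_trans _ _ (B ^+ 2)).
    by rewrite lerXn2r ?nnegrE ?addr_ge0//; lra.
  by rewrite (le_trans MB)// ler_wpM2l// lerDl.
have := root_mean_gauss_ent_le wN JN sT0 h; rewrite -/eps.
rewrite [s + T + _]addrAC -[s + _ + T]addrA.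
have : (s + T) * eps <= S * eps.
  by rewrite ler_wpM2r//; apply: le_trans sS; rewrite lerD2l lerDr.
rewrite -natr1 [(n%:R + 1) * _]mulrDl mul1r.
move: (root_mean _ _ _) (gauss_ent_at _ _) ((s + T) * eps) (S * eps) (s * ln s)
 (n%:R * _) => x1 x2 x3 x4 x5 x6.
lra.
Qed.

End TorusMean.

End EntropyStep.

(** * The Khinchine inequality near the exponent 2 *)

Section Khinchine.
Context {R : realType}.
Notation C := R[i].
Let gamma : R := euler_gamma R.

Lemma normc_real (x : R) : normc x%:C = `|x|.
Proof. by rewrite /normc/= expr0n addr0 sqrtr_sqr. Qed.

(** Take s = t^2 with t small: - t^2 ln (t^2) <= 2 t, and all other terms are
bounded by multiples of t as well. *)
Lemma small_entropy_error (delta : R) : 0 < delta ->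
  exists2 s : R, 0 < s <= 1 & gauss_ent_at 0 (s + 1) - s * ln s <= 1 - gamma + delta.
Proof.
move=> d0; pose c := 1 - gamma.
have c0 : 0 <= c by rewrite subr_ge0 euler_gamma_le1.
(* The error is at most (4 + c) t; [D] makes t <= 1 as well. *)
pose D := 2 * (4 + c) + delta.
have D0 : 0 < D by rewrite ltr_wpDl// mulr_ge0// addr_ge0.
pose t := delta / D.
have t0 : 0 < t by rewrite divr_gt0.
have tD : t * D = delta by rewrite divfK// gt_eqF.
have t1 : t <= 1 by rewrite ler_pdivrMr// mul1r lerDr mulr_ge0// addr_ge0.
have tc : t * (4 + c) <= delta.
  rewrite -tD ler_pM2l// /D.
  have : 0 <= 4 + c by rewrite addr_ge0.
  by move: (4 + c) => x x0; lra.
exists (t ^+ 2); first by rewrite exprn_gt0//= expr_le1// ltW.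
have tt : t ^+ 2 <= t by rewrite expr2 ler_piMl// ltW.
have t20 : 0 < t ^+ 2 by rewrite exprn_gt0.
rewrite gauss_ent_at0; last by rewrite ltr_wpDl ?ltW.
have h1 : (t ^+ 2 + 1) * ln (t ^+ 2 + 1) <= (t ^+ 2 + 1) * t ^+ 2.
  rewrite ler_wpM2l ?addr_ge0 ?(ltW t20)//.
  by rewrite -[leRHS](addrK 1); apply: ln_le_sub1; rewrite ltr_wpDl ?ltW.
have h2 : - (t ^+ 2 * ln (t ^+ 2)) <= 2 * t.
  have := ln_le_sub1 (x := t^-1); rewrite invr_gt0 => /(_ t0).
  rewrite lnV ?posrE// lnXn// -mulr_natl => h.
  have : 2 * t ^+ 2 * (- ln t) <= 2 * t ^+ 2 * (t^-1 - 1).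
    by rewrite ler_wpM2l// mulr_ge0// ltW.
  have -> : 2 * t ^+ 2 * (t^-1 - 1) = 2 * t - 2 * t ^+ 2 by field; rewrite gt_eqF.
  have : 0 <= t ^+ 2 by exact: ltW.
  by move: (ln t) (t ^+ 2) => x y; lra.
have h3 : (1 - gamma) * t ^+ 2 <= (1 - gamma) * t by rewrite ler_wpM2l.
have h4 : (t ^+ 2 + 1) * t ^+ 2 <= (1 + 1) * t.
  by rewrite ler_pM// ?addr_ge0 ?(ltW t20)// lerD2r (le_trans tt).
have e1 : (1 - gamma) * (t ^+ 2 + 1) = (1 - gamma) * t ^+ 2 + (1 - gamma) by ring.
have e2 : t * (4 + c) = 4 * t + (1 - gamma) * t by rewrite /c; ring.
move: h1 h2 h3 h4 tc; rewrite -/gamma e1 e2.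
move: ((t ^+ 2 + 1) * ln _) (t ^+ 2 * ln _) ((t ^+ 2 + 1) * t ^+ 2).
move: ((1 - gamma) * t ^+ 2) ((1 - gamma) * t) => x1 x2 x3 x4 x5.
by lra.
Qed.

Lemma exists_exp_coeff_le (x eps : R) : 0 < eps ->
  exists J : nat, x ^+ J.*2.+2 / J.*2.+2`!%:R <= eps.
Proof.
move=> eps0; have /cvgrPdist_le/(_ eps eps0)[K _ h] := @cvg_exp_coeff R x.
exists K; have /= := h K.*2.+2.
rewrite sub0r normrN => hK; apply: le_trans (ler_norm _) _; apply: hK.
by rewrite -addnn (leq_trans (leq_addr K K))// -addn2 leq_addr.
Qed.

(** A normalised Steinhaus sum has at most the entropy 1 - gamma of a standard
Gaussian variable, up to an error that does not depend on the
coefficients. *)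
Lemma steinhaus_entropy (n : nat) (delta : R) : 0 < delta ->
  exists N : nat, exists w : C, [/\ (1 < N)%N, N.-primitive_root w &
    forall a : nat -> C, \sum_(i < n) normc (a i) ^+ 2 = 1 ->
    torus_mean N w n (fun l => normc (steinhaus_sum n a l) ^+ 2 *
                    ln (normc (steinhaus_sum n a l) ^+ 2)) <=
    1 - gamma + delta].
Proof.
move=> d0; have d20 : 0 < delta / 2 by rewrite divr_gt0.
have [s /andP[s0 s1] hs] := small_entropy_error d20.
(* One half of delta pays for [s], the other for [n] Taylor remainders; a
   normalised sum of [n] terms is bounded by [n]. *)
pose M := n%:R ^+ 2 / s.
have e0 : 0 < delta / 2 / (2 * n.+1%:R) by rewrite divr_gt0// mulr_gt0.
have [J hJ] := exists_exp_coeff_le M e0.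
have [w wN] := @prim_root_exists R J.*2.+2 isT.
exists J.*2.+2, w; split => // a a1.
have a1' i : (i < n)%N -> normc (a i) <= 1.
  move=> il; rewrite -(@expr_le1 _ 2)// ?normc_ge0// -a1.
  rewrite (bigD1 (Ordinal il))//= lerDl sumr_ge0// => j _.
  by rewrite exprn_ge0// normc_ge0.
have := @torus_mean_ent_le _ J.*2.+2 w isT wN J n 0 a s 2 M n%:R (ltnSn _) s0 a1'.
rewrite normc0 add0r a1 expr0n/= => /(_ (lexx _)).
have -> : M * s = n%:R ^+ 2 by rewrite divfK// gt_eqF.
have s2 : s + 1 <= 2 by lra.
move=> /(_ s2 (lexx _)).
under eq_fun do rewrite add0r.
move=> /le_trans; apply.
have -> : 1 - gamma + delta = (1 - gamma + delta / 2) + delta / 2 by lra.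
apply: lerD => //.
have -> : delta / 2 = n.+1%:R * (2 * (delta / 2 / (2 * n.+1%:R))).
  have : n.+1%:R != 0 :> R by rewrite pnatr_eq0.
  by move: (n.+1%:R) => x xn0; field.
apply: (@le_trans _ _ (n%:R * (2 * (delta / 2 / (2 * n.+1%:R))))).
  by rewrite ler_wpM2l// ler_wpM2l.
by rewrite ler_wpM2r ?ler_nat// mulr_ge0// ltW.
Qed.

(** x^(1 - theta) = x exp (- theta M) exp (- theta (ln x - M)), and the last
factor is at least its tangent 1 - theta (ln x - M).  If theta >= 0
and x is random of mean 1, the mean of the left side is at least exp (- theta M) as soon as the
entropy of x is at most M. *)
Lemma powR_ge_entropy (x M theta : R) : 0 <= x -> theta < 1 ->
  expR (- (theta * M)) * (x * (1 + theta * M) - theta * (x * ln x)) <=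
  x `^ (1 - theta).
Proof.
rewrite le_eqVlt => /predU1P[<-|x0] t1.
  by rewrite powR0 ?gt_eqF ?subr_gt0// !mul0r mulr0 subr0 mulr0.
rewrite /powR gt_eqF// mulrBl mul1r expRD lnK ?posrE//.
have -> : - (theta * ln x) = - (theta * M) + (- (theta * (ln x - M))) by ring.
rewrite expRD [leRHS]mulrCA ler_wpM2l ?expR_ge0//.
have -> : x * (1 + theta * M) - theta * (x * ln x) =
    x * (1 + - (theta * (ln x - M))) by ring.
by rewrite ler_wpM2l ?(ltW x0)// expR_ge1Dx.
Qed.

(** By homogeneity the sum of the |a_i|^2 may be taken to be 1, and then
[powR_ge_entropy] is averaged.  The order N serves all coefficients and all
theta. *)
Theorem steinhaus_khinchine (n : nat) (delta : R) : 0 < delta ->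
  exists N : nat, exists w : C, [/\ (1 < N)%N, N.-primitive_root w &
    forall (a : nat -> C) (theta : R), 0 <= theta < 1 ->
    expR (- (theta * (1 - gamma + delta))) *
      (\sum_(i < n) normc (a i) ^+ 2) `^ (1 - theta) <=
    torus_mean N w n (fun l => (normc (steinhaus_sum n a l) ^+ 2) `^ (1 - theta))].
Proof.
move=> d0; have [N [w [N1 wN hent]]] := steinhaus_entropy n d0.
have N0 : (0 < N)%N by exact: ltn_trans N1.
exists N, w; split => // a theta /andP[t0 t1].
set M := 1 - gamma + delta in hent *.
set V := \sum_(i < n) _.
have V0 : 0 <= V by apply: sumr_ge0 => i _; rewrite exprn_ge0// normc_ge0.
move: V0; rewrite le_eqVlt => /predU1P[V0|V0].
  rewrite -V0 powR0 ?gt_eqF ?subr_gt0// mulr0 -(torus_mean_cst w N0 n 0).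
  by apply: ler_torus_mean => // l _ _; exact: powR_ge0.
pose sigma := Num.sqrt V.
have sig0 : 0 < sigma by rewrite sqrtr_gt0.
have sig2 : sigma ^+ 2 = V by rewrite sqr_sqrtr// ltW.
pose b i := (sigma^-1)%:C * a i.
have nb i : normc (b i) ^+ 2 = V^-1 * normc (a i) ^+ 2.
  rewrite /b normcM normc_real exprMn ger0_norm ?invr_ge0 ?(ltW sig0)//.
  by rewrite exprVn sig2.
have b1 : \sum_(i < n) normc (b i) ^+ 2 = 1.
  under eq_bigr do rewrite nb.
  by rewrite -mulr_sumr mulVf// gt_eqF.
have Sb l : normc (steinhaus_sum n a l) ^+ 2 = V * normc (steinhaus_sum n b l) ^+ 2.
  have -> : steinhaus_sum n b l = (sigma^-1)%:C * steinhaus_sum n a l.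
    by rewrite /steinhaus_sum mulr_sumr; apply: eq_bigr => i _; rewrite mulrA.
  rewrite normcM normc_real exprMn ger0_norm ?invr_ge0 ?(ltW sig0)//.
  by rewrite exprVn sig2 mulrA divff ?mul1r// gt_eqF.
have U0 l : 0 <= normc (steinhaus_sum n b l) ^+ 2 by rewrite exprn_ge0// normc_ge0.
under eq_fun do rewrite Sb powRM ?(ltW V0)//.
rewrite torus_meanZ mulrC ler_wpM2l ?powR_ge0//.
have h := hent b b1.
have h2 := @torus_mean_sqr _ N w N0 wN n 0 b N1.
rewrite normc0 expr0n add0r b1 in h2.
apply: (@le_trans _ _ (torus_mean N w n (fun l =>
   expR (- (theta * M)) * ((1 + theta * M) * normc (steinhaus_sum n b l) ^+ 2 +
   (- theta) * (normc (steinhaus_sum n b l) ^+ 2 *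
     ln (normc (steinhaus_sum n b l) ^+ 2)))))); last first.
  apply: ler_torus_mean => // l _ _.
  apply: le_trans (powR_ge_entropy M (U0 l) t1).
  by rewrite le_eqVlt; apply/orP; left; apply/eqP; ring.
rewrite torus_meanZ torus_meanD !torus_meanZ.
rewrite -[leLHS]mulr1 ler_wpM2l ?expR_ge0//.
have -> : torus_mean N w n (fun l => normc (steinhaus_sum n b l) ^+ 2) = 1.
  by rewrite -[RHS]h2; congr torus_mean; apply/funext => l; rewrite add0r.
have : theta * torus_mean N w n (fun l => normc (steinhaus_sum n b l) ^+ 2 *
     ln (normc (steinhaus_sum n b l) ^+ 2)) <= theta * M by rewrite ler_wpM2l.
by rewrite mulNr mulr1; move: (theta * M) (theta * _) => x y; lra.
Qed.

End Khinchine.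

(** * Hoelder's inequality with equal weights *)

Section Holder.
Context {R : realType}.

Lemma prod_powR (I : Type) (r : seq I) (f : I -> R) (a : R) :
  (forall i, 0 <= f i) ->
  \prod_(i <- r) f i `^ a = (\prod_(i <- r) f i) `^ a.
Proof.
move=> f0; elim: r => [|i r ih]; first by rewrite !big_nil powR1.
by rewrite !big_cons powRM ?ih// prodr_ge0.
Qed.

Lemma prod_le_mean (T : Type) (Ys : seq T) (z : T -> R) : (0 < size Ys)%N ->
  (forall Y, 0 <= z Y) ->
  \prod_(Y <- Ys) z Y `^ (size Ys)%:R^-1 <= (\sum_(Y <- Ys) z Y) / (size Ys)%:R.
Proof.
case: Ys => // Y0 Ys; set Zs := Y0 :: Ys => sz z0.
rewrite prod_powR//.
have S0 : 0 <= (\sum_(Y <- Zs) z Y) / (size Zs)%:R.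
  by rewrite divr_ge0// sumr_ge0.
have := @leif_AGM R 'I_(size Zs) predT (fun i => z (nth Y0 Zs i)) (fun i _ => z0 _).
rewrite card_ord.
rewrite -(big_mkord xpredT (fun i => z (nth Y0 Zs i))) -(big_nth Y0 xpredT z).
rewrite -(big_mkord xpredT (fun i => z (nth Y0 Zs i))) -(big_nth Y0 xpredT z).
case=> + _ => h.
have {}h : (\prod_(Y <- Zs) z Y) `^ (size Zs)%:R^-1 <=
    (((\sum_(Y <- Zs) z Y) / (size Zs)%:R) ^+ size Zs) `^ (size Zs)%:R^-1.
  by apply: ge0_ler_powR => //; rewrite nnegrE ?prodr_ge0 ?exprn_ge0.
apply: (le_trans h); rewrite -powR_mulrn// -powRrM mulfV ?pnatr_eq0//.
by rewrite powRr1.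
Qed.

(** Divide each f Y by its sum over r and apply the inequality of arithmetic
and geometric means at every y. *)
Lemma holder_sum (J : eqType) (T : Type) (r : seq J) (Ys : seq T) (f : T -> J -> R) :
  (0 < size Ys)%N -> (forall Y y, 0 <= f Y y) ->
  \sum_(y <- r) \prod_(Y <- Ys) f Y y `^ (size Ys)%:R^-1 <=
  \prod_(Y <- Ys) (\sum_(y <- r) f Y y) `^ (size Ys)%:R^-1.
Proof.
move=> sz f0; set M := (size Ys)%:R^-1.
pose A Y := \sum_(y <- r) f Y y.
have A0 Y : 0 <= A Y by exact: sumr_ge0.
have prodA0 : 0 <= \prod_(Y <- Ys) A Y `^ M.
  by apply: prodr_ge0 => Y _; exact: powR_ge0.
pose z y Y := f Y y / A Y.
have z0 y Y : 0 <= z y Y by rewrite divr_ge0.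
have le1 : \sum_(y <- r) \prod_(Y <- Ys) z y Y `^ M <= 1.
  apply: (@le_trans _ _ (\sum_(y <- r) (\sum_(Y <- Ys) z y Y) * M)).
    by apply: ler_sum => y _; exact: prod_le_mean.
  rewrite -mulr_suml exchange_big/= ler_pdivrMr ?ltr0n// mul1r.
  rewrite -[leRHS]mulr1 -sum1_size natr_sum.
  rewrite mulr1; apply: ler_sum => Y _; rewrite /z -mulr_suml -/(A Y).
  by have [->|AY] := eqVneq (A Y) 0; rewrite ?mul0r ?divff.
rewrite -[leRHS]mulr1 (le_trans _ (ler_wpM2l prodA0 le1))// mulr_sumr.
rewrite big_seq [leRHS]big_seq; apply: ler_sum => y yr.
rewrite -big_split/=; apply: ler_prod => Y _; rewrite powR_ge0/=.
rewrite -powRM// /z; have [AY|AY] := eqVneq (A Y) 0; last by rewrite mulrC divfK.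
(* If the sum [A Y] vanishes then so does its term [f Y y]. *)
have : f Y y <= A Y.
  by rewrite /A (big_rem y)//= lerDl sumr_ge0.
rewrite AY mul0r => fy; suff -> : f Y y = 0 by [].
by apply/eqP; rewrite eq_le fy f0.
Qed.

End Holder.

(** * Sums over coordinates and the Loomis-Whitney inequality *)

Section CoordinateSums.
Context {R : realType} {I : eqType} {T : Type}.
Context (n : nat) (e : nat -> T).
Implicit Types (x : I -> T) (H G : (I -> T) -> R) (j k : I) (js ls : seq I).

Lemma dfwithE x i u j : dfwith x i u j = if i == j then u else x j.
Proof. by case: eqVneq => [<-|ij]; rewrite ?dfwithin ?dfwithout. Qed.

Lemma dfwithC x j k u v : j != k ->
  dfwith (dfwith x j u) k v = dfwith (dfwith x k v) j u.
Proof.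
move=> jk; apply/funext => i; rewrite !dfwithE.
by case: eqVneq => // <-; rewrite (negbTE jk).
Qed.

Lemma dfwith_idem x j u v : dfwith (dfwith x j u) j v = dfwith x j v.
Proof. by apply/funext => i; rewrite !dfwithE; case: eqVneq. Qed.

Lemma dfwith_self x j : dfwith x j (x j) = x.
Proof. by apply/funext => i; rewrite dfwithE; case: eqVneq => // ->. Qed.

(** Sum over the coordinate j of a function of points indexed by I, where j
runs through e 0, ..., e (n-1) and the other coordinates are kept.  Summing
functions of points, rather than arrays of numbers, lets the same operation
apply when some coordinates are not among the e y. *)
Definition coord_sum j H : (I -> T) -> R :=
  fun x => \sum_(y < n) H (dfwith x j (e y)).

Definition coord_sums js H : (I -> T) -> R := foldr coord_sum H js.

Definition indep_coord j H := forall x u, H (dfwith x j u) = H x.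

Lemma coord_sumC j k H : coord_sum j (coord_sum k H) = coord_sum k (coord_sum j H).
Proof.
have [->//|jk] := eqVneq j k.
apply/funext => x; rewrite /coord_sum exchange_big/=; apply: eq_bigr => y _.
by apply: eq_bigr => z _; rewrite dfwithC.
Qed.

Lemma coord_sumsC j js H :
  coord_sum j (coord_sums js H) = coord_sums js (coord_sum j H).
Proof. by elim: js => //= k js <-; rewrite coord_sumC. Qed.

Lemma coord_sums_rem k js H : k \in js ->
  coord_sums js H = coord_sums (rem k js) (coord_sum k H).
Proof.
elim: js => //= j js ih; rewrite inE; case: eqVneq => [->|_] /=.
  by rewrite coord_sumsC.
by move=> kjs; rewrite ih.
Qed.

Lemma indep_coord_sum j k H : indep_coord j H -> indep_coord j (coord_sum k H).
Proof.
move=> Hj x u; apply: eq_bigr => y _.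
have [->|jk] := eqVneq j k; first by rewrite dfwith_idem.
by rewrite dfwithC// Hj.
Qed.

Lemma indep_coord_sum_self k H : indep_coord k (coord_sum k H).
Proof. by move=> x u; apply: eq_bigr => y _; rewrite dfwith_idem. Qed.

Lemma indep_coord_sums j js H : indep_coord j H -> indep_coord j (coord_sums js H).
Proof. by move=> Hj; elim: js => //= k js ih; exact: indep_coord_sum. Qed.

Lemma coord_sums_dfwith k u js H x : k \notin js ->
  coord_sums js (fun x => H (dfwith x k u)) x = coord_sums js H (dfwith x k u).
Proof.
elim: js x => //= j js ih x; rewrite inE negb_or => /andP[kj kjs].
by apply: eq_bigr => y _; rewrite ih// dfwithC// eq_sym.
Qed.

(** The sum at x only sees points that differ from x in the coordinates js,
where they take values e y. *)
Lemma ler_coord_sums js H G x :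
  (forall x', (forall k, k \in js -> exists2 y, (y < n)%N & x' k = e y) ->
    (forall k, k \notin js -> x' k = x k) -> H x' <= G x') ->
  coord_sums js H x <= coord_sums js G x.
Proof.
elim: js x => [|j js ih] x HG /=; first exact: HG.
apply: ler_sum => y _; apply: ih => x' x'js x'njs; apply: HG => k.
  rewrite inE; have [|kjs] := boolP (k \in js); first by move=> /x'js.
  rewrite orbF => /eqP kj; exists y => //.
  by rewrite x'njs// dfwithE kj eqxx.
rewrite inE negb_or => /andP[kj kjs].
by rewrite x'njs// dfwithE eq_sym (negbTE kj).
Qed.

Lemma ler_coord_sums_all js H G x : (forall x, H x <= G x) ->
  coord_sums js H x <= coord_sums js G x.
Proof. by move=> HG; apply: ler_coord_sums => x' _ _. Qed.

Lemma coord_sums_ge0 js H x : (forall x, 0 <= H x) -> 0 <= coord_sums js H x.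
Proof. by move=> H0; elim: js x => //= j js ih x; exact: sumr_ge0. Qed.

Lemma coord_sumsZ js (c : R) H x :
  coord_sums js (fun x => c * H x) x = c * coord_sums js H x.
Proof.
by elim: js x => //= j js ih x; rewrite mulr_sumr; apply: eq_bigr => y _.
Qed.

Lemma holder_coord_sums (U : Type) (Ys : seq U) (f : U -> (I -> T) -> R) js x :
  (0 < size Ys)%N -> (forall Y x, 0 <= f Y x) ->
  coord_sums js (fun x => \prod_(Y <- Ys) f Y x `^ (size Ys)%:R^-1) x <=
  \prod_(Y <- Ys) (coord_sums js (f Y) x) `^ (size Ys)%:R^-1.
Proof.
move=> sz f0; elim: js x => //= j js ih x.
apply: (@le_trans _ _ (\sum_(y < n) \prod_(Y <- Ys)
    coord_sums js (f Y) (dfwith x j (e y)) `^ (size Ys)%:R^-1)).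
  by apply: ler_sum => y _; exact: ih.
apply: (@holder_sum R _ U _ Ys
  (fun Y (y : 'I_n) => coord_sums js (f Y) (dfwith x j (e y)))) => //.
by move=> Y y; exact: coord_sums_ge0.
Qed.

(** Sum over the coordinates one at a time.  When j is summed, the factor F j
does not depend on it and comes out of the sum; Hoelder's inequality applies
to the other factors, whose number |K| - 1 is the inverse of the exponent. *)
Lemma loomis_whitney (K ls : seq I) (F : I -> (I -> T) -> R) x :
  uniq K -> (1 < size K)%N -> uniq ls -> {subset ls <= K} ->
  (forall k x, 0 <= F k x) -> (forall k, indep_coord k (F k)) ->
  coord_sums ls (fun x => \prod_(k <- K) F k x `^ (size K).-1%:R^-1) x <=
  \prod_(k <- K) (coord_sums (rem k ls) (F k) x) `^ (size K).-1%:R^-1.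
Proof.
move=> Ku K1 + + F0 Find; elim: ls x => [|j ls ih] x //= /andP[jls lsu] jlsK.
have jK : j \in K by rewrite jlsK// mem_head.
have lsK : {subset ls <= K} by move=> k kls; rewrite jlsK// inE kls orbT.
set w := (size K).-1%:R^-1 in ih *.
pose Y k := coord_sums (rem k ls) (F k).
have Y0 k z : 0 <= Y k z by exact: coord_sums_ge0.
apply: (@le_trans _ _ (coord_sum j (fun x => \prod_(k <- K) (Y k x) `^ w) x)).
  by apply: ler_sum => y _; exact: ih.
rewrite (big_rem j)//= eqxx.
have YjE : Y j = coord_sums ls (F j) by rewrite /Y rem_id.
have Yjind : indep_coord j (Y j) by exact: indep_coord_sums.
have -> : coord_sum j (fun x => \prod_(k <- K) (Y k x) `^ w) x =
    Y j x `^ w * coord_sum j (fun x => \prod_(k <- rem j K) (Y k x) `^ w) x.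
  rewrite /coord_sum mulr_sumr; apply: eq_bigr => y _.
  by rewrite (big_rem j)//= Yjind.
rewrite YjE ler_wpM2l ?powR_ge0//.
have wE : w = (size (rem j K))%:R^-1 by rewrite size_rem.
have r0 : (0 < size (rem j K))%N by rewrite size_rem// -ltnS prednK// ltnW.
rewrite wE; apply: (le_trans (@holder_sum R _ I (index_enum _) _
  (fun k (y : 'I_n) => Y k (dfwith x j (e y))) r0 (fun k y => Y0 k _))).
rewrite big_seq [leRHS]big_seq; apply: ler_prod => k kK; rewrite powR_ge0/=.
have jk : j != k by apply: contraTneq kK => <-; rewrite mem_rem_uniq// !inE eqxx.
by rewrite (negbTE jk).
Qed.

End CoordinateSums.

(** * Interpolation of mixed sums *)

Section Blei.
Context {R : realType} {I : eqType} {T : Type}.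
Context (n : nat) (e : nat -> T).
Implicit Types (x : I -> T) (H : (I -> T) -> R) (js : seq I).

(** Let N = m + 2 be the number of coordinates, V_k the sum of H^2 over the
coordinate k, and X_k = H^2 V_k^(-1/N).  Then
    H^(2N/(N+1)) = (prod_k V_k^(1/N))^(1/(N+1)) prod_k X_k^(1/(N+1)),
and Hoelder's inequality with N + 1 factors applies.  The sum of X_k over the
coordinate k is V_k^((N-1)/N), so its full sum is one of the mixed sums of the
hypothesis.  The product of the V_k^(1/N) is bounded by
[loomis_whitney], applied to the functions V_k^((N-1)/N). *)
Lemma blei (m : nat) js H (D : R) x : size js = m.+2 -> uniq js ->
  (forall x, 0 <= H x) -> 0 <= D ->
  (forall k, k \in js -> coord_sums n e (rem k js)
     (fun x => coord_sum n e k (fun x => H x ^+ 2) x `^ (m.+1%:R / m.+2%:R)) x <=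
     D `^ (2 * m.+1%:R / m.+2%:R)) ->
  coord_sums n e js (fun x => H x `^ (2 * m.+2%:R / m.+3%:R)) x <=
  D `^ (2 * m.+2%:R / m.+3%:R).
Proof.
move=> sz ju H0 D0 UD.
pose V k := coord_sum n e k (fun x => H x ^+ 2).
have V0 k z : 0 <= V k z by apply: sumr_ge0 => y _; exact: exprn_ge0.
have Vind k : indep_coord k (V k) by exact: indep_coord_sum_self.
have m1 : 0 < m.+1%:R :> R by [].
have m2 : 0 < m.+2%:R :> R by [].
have m3 : 0 < m.+3%:R :> R by [].
have m21 : m.+2%:R = m.+1%:R + 1 :> R by rewrite natr1.
have m31 : m.+3%:R = m.+1%:R + 2 :> R by rewrite -natr1 m21 -addrA.
pose X k z := H z ^+ 2 * V k z `^ (- m.+2%:R^-1).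
pose W z := \prod_(k <- js) V k z `^ (m.+2%:R^-1).
pose Ys : seq (option I) := None :: [seq Some k | k <- js].
have szY : size Ys = m.+3 by rewrite /= size_map sz.
have X0 k z : 0 <= X k z by rewrite mulr_ge0 ?exprn_ge0 ?powR_ge0.
have W0 z : 0 <= W z by apply: prodr_ge0 => k _; exact: powR_ge0.
pose f (Y : option I) := if Y is Some k then X k else W.
have f0 Y z : 0 <= f Y z by case: Y => [k|] /=.
set q := 2 * m.+2%:R / m.+3%:R.
set Up := D `^ (2 * m.+1%:R / m.+2%:R) in UD *.
have Up0 : 0 <= Up by exact: powR_ge0.
have sX k : k \in js -> coord_sums n e js (X k) x <= Up.
  move=> kjs; rewrite (coord_sums_rem _ _ _ kjs).
  apply: le_trans (UD k kjs); apply: ler_coord_sums_all => z.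
  rewrite /coord_sum /X.
  under eq_bigr do rewrite Vind.
  rewrite -mulr_suml -/(coord_sum n e k _ z) -/(V k z).
  have -> : m.+1%:R / m.+2%:R = 1 - m.+2%:R^-1 :> R.
    by rewrite -[m.+1%:R](addrK 1) -m21 mulrBl divff ?gt_eqF// mul1r.
  have hp : 0 < 1 - m.+2%:R^-1 :> R by rewrite subr_gt0 invf_lt1// ltr1n.
  by rewrite -(mulr_powRB1 (V0 k z) hp) [1 - _ - 1]addrAC subrr add0r.
have sW : coord_sums n e js W x <= (Up `^ m.+1%:R^-1) ^+ m.+2.
  have := @loomis_whitney R I T n e js js
    (fun k z => V k z `^ (m.+1%:R / m.+2%:R)) x ju.
  rewrite sz => /(_ isT ju (fun k h => h) (fun _ _ => powR_ge0 _ _)).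
  have ind k : indep_coord k (fun z => V k z `^ (m.+1%:R / m.+2%:R)).
    by move=> z u; rewrite Vind.
  move=> /(_ ind).
  rewrite (_ : (fun _ => \prod_(k <- js) _) = W); last first.
    apply/funext => z; apply: eq_bigr => k _; rewrite -powRrM; congr (_ `^ _).
    by rewrite mulrAC divff ?gt_eqF// mul1r.
  move=> /le_trans; apply.
  apply: (@le_trans _ _ (\prod_(k <- js) Up `^ m.+1%:R^-1)).
    rewrite big_seq [leRHS]big_seq; apply: ler_prod => k kjs; rewrite powR_ge0/=.
    apply: ge0_ler_powR; rewrite ?nnegrE ?invr_ge0 ?UD//.
    by apply: coord_sums_ge0 => z; exact: powR_ge0.
  by rewrite big_const_seq count_predT sz iter_mulr_1.
apply: (@le_trans _ _ (coord_sums n e js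
    (fun z => \prod_(Y <- Ys) f Y z `^ (size Ys)%:R^-1) x)).
  apply: ler_coord_sums => z zjs _; rewrite szY.
  (* Where H > 0, also V_k > 0 for every k: at the points that are summed, the
     coordinate k is some e y, so that H^2 is one of the terms of V_k. *)
  have [Hz|Hz] := eqVneq (H z) 0.
    rewrite Hz powR0 ?gt_eqF ?divr_gt0 ?mulr_gt0//.
    by apply: prodr_ge0 => Y _; exact: powR_ge0.
  have Hz0 : 0 < H z by rewrite lt_neqAle eq_sym Hz H0.
  have Vz k : k \in js -> 0 < V k z.
    move=> /zjs[y yn zk]; rewrite (lt_le_trans (y := H z ^+ 2)) ?exprn_gt0//.
    rewrite /V /coord_sum (bigD1 (Ordinal yn))//= -zk dfwith_self lerDl.
    by apply: sumr_ge0 => i _; exact: exprn_ge0.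
  rewrite big_cons big_map /W -prod_powR => [|k]; last exact: powR_ge0.
  rewrite -big_split/= big_seq.
  rewrite (eq_bigr (fun=> (H z ^+ 2) `^ m.+3%:R^-1)); last first.
    move=> k kjs; rewrite -powRM ?powR_ge0 ?X0// /X.
    rewrite mulrCA -powRD ?addrN ?eqxx//; last by rewrite gt_eqF ?Vz ?implybT.
    by rewrite powRr0 mulr1.
  rewrite -big_seq big_const_seq count_predT sz iter_mulr_1.
  rewrite -[_ ^+ m.+2]powR_mulrn ?powR_ge0// -[H z ^+ 2]powR_mulrn ?H0//.
  rewrite -!powRrM /q le_eqVlt; apply/orP; left.
  by apply/eqP; congr (_ `^ _); ring.
apply: (le_trans (holder_coord_sums n e js x _ f0)); first by rewrite szY.
rewrite szY big_cons big_map/=.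
apply: (@le_trans _ _ (((Up `^ m.+1%:R^-1) ^+ m.+2) `^ m.+3%:R^-1 *
    (Up `^ m.+3%:R^-1) ^+ m.+2)).
  apply: ler_pM; rewrite ?powR_ge0//.
  - by apply: prodr_ge0 => k _; exact: powR_ge0.
  - apply: ge0_ler_powR; rewrite ?nnegrE ?invr_ge0 ?exprn_ge0 ?powR_ge0//.
    exact: coord_sums_ge0.
  - apply: (@le_trans _ _ (\prod_(k <- js) Up `^ m.+3%:R^-1)).
      rewrite big_seq [leRHS]big_seq; apply: ler_prod => k kjs; rewrite powR_ge0/=.
      apply: ge0_ler_powR; rewrite ?nnegrE ?invr_ge0 ?sX//.
      exact: coord_sums_ge0.
    by rewrite big_const_seq count_predT sz iter_mulr_1.
have UpX (a : R) : (Up `^ a) ^+ m.+2 = D `^ (2 * m.+1%:R / m.+2%:R * (a * m.+2%:R)).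
  by rewrite powRrM -/Up powRrM powR_mulrn// powR_ge0.
rewrite !UpX -powRrM.
have [->|Dn0] := eqVneq D 0.
  rewrite [X in X * _]powR0 ?mul0r ?powR_ge0// mulf_neq0 ?mulf_neq0 ?invr_eq0 ?gt_eqF//.
rewrite -powRD ?Dn0 ?implybT// le_eqVlt; apply/orP; left; apply/eqP.
congr (_ `^ _); rewrite /q.
have := lt0r_neq0 m1; have := lt0r_neq0 m2; have := lt0r_neq0 m3; rewrite m31 m21.
by move: (m.+1%:R) => a a3 a2 a1; field; rewrite a1 a2 a3.
Qed.

End Blei.

(** * The induction on the number of variables *)

Section BohnenblustHille.
Context {R : realType} {m : nat}.
Notation C := R[i].
Context (L : ('I_m -> c0 R) -> C^o).
Context (Lmult : multilinear L).
Implicit Types (x : 'I_m -> c0 R) (k : 'I_m) (js : seq 'I_m).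

Definition unit_point x := forall i, `|x i| <= 1.

(** The null sequence that starts with the first n entries of l, completed
by zeros. *)
Definition c0_vector (n : nat) (l : seq C) : c0 R :=
  \sum_(y < n) (l`_y : C) *: c0_basis y.

Lemma c0_norm_le1 (u : c0 R) : (forall t, normc (u t) <= 1) -> `|u| <= 1.
Proof.
move=> u1; rewrite -[1]/((1 : R)%:C) lecR; exact: c0_norm_le.
Qed.

Lemma c0_vectorE n l t : c0_vector n l t = if (t < n)%N then l`_t else 0.
Proof.
rewrite /c0_vector.
have valS : forall (r : seq 'I_n), (\sum_(y <- r) (l`_y : C) *: c0_basis y : c0 R) t =
    \sum_(y <- r) l`_y * (t == y :> nat)%:R.
  elim=> [|y r ih]; first by rewrite !big_nil.
  by rewrite !big_cons -ih.
rewrite valS; case: ifPn => [tn|].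
  rewrite (bigD1 (Ordinal tn))//= eqxx mulr1 big1 ?addr0// => y yt.
  rewrite (_ : (t == y) = false) ?mulr0//; apply/negbTE; apply: contraNneq yt => ty.
  by apply/eqP/val_inj.
rewrite -leqNgt => nt; rewrite big1// => y _.
by rewrite gtn_eqF ?mulr0// (leq_trans (ltn_ord y)).
Qed.

Lemma c0_vector_le1 n l : all (fun z => normc z <= 1) l -> `|c0_vector n l| <= 1.
Proof.
move=> l1; apply: c0_norm_le1 => t; rewrite c0_vectorE; case: ifP => _.
  have [tl|lt] := ltnP t (size l); first exact: (all_nthP 0 l1).
  by rewrite nth_default// normc0.
by rewrite normc0.
Qed.

Lemma unit_dfwith x k u : unit_point x -> `|u| <= 1 -> unit_point (dfwith x k u).
Proof. by move=> x1 u1 i; rewrite dfwithE; case: ifP. Qed.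

Lemma multilinear_vector x k n l :
  L (dfwith x k (c0_vector n l)) = \sum_(y < n) l`_y * L (dfwith x k (c0_basis y)).
Proof.
have Llin := Lmult k x.
have L0 : L (dfwith x k 0) = 0.
  have := Llin 1 0 0; rewrite scaler0 addr0 scale1r => /eqP.
  by rewrite -subr_eq0 opprD addrA subrr add0r oppr_eq0 => /eqP.
rewrite /c0_vector; elim: (index_enum _) => [|y r ih]; first by rewrite !big_nil.
by rewrite !big_cons Llin ih.
Qed.

(** The product of the Khinchine constants of p induction steps, when the
entropy is bounded by mu: the step to k + 1 variables contributes the factor
exp (mu / (2 k)). *)
Definition BH_constant (mu : R) (p : nat) : R := expR (mu / 2 * series harmonic p).

Definition BH_exponent (p : nat) : R := 2 * p%:R / p.+1%:R.

Section Induction.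
Context (n : nat) (M mu : R) (N : nat) (w : C).
Context (LM : forall x, unit_point x -> normc (L x) <= M).
Context (N0 : (0 < N)%N) (wN : N.-primitive_root w).
Context (khinchine : forall (a : nat -> C) (theta : R), 0 <= theta < 1 ->
  expR (- (theta * mu)) * (\sum_(i < n) normc (a i) ^+ 2) `^ (1 - theta) <=
  torus_mean N w n (fun l => (normc (steinhaus_sum n a l) ^+ 2) `^ (1 - theta))).

Let e := @c0_basis R.
Let absL x := normc (L x).

Lemma coord_sums_torus_mean js (F : seq C -> ('I_m -> c0 R) -> R) x :
  coord_sums n e js (fun x => torus_mean N w n (fun l => F l x)) x =
  torus_mean N w n (fun l => coord_sums n e js (F l) x).
Proof.
elim: js x => //= j js ih x; rewrite /coord_sum torus_mean_sum//.
by apply: eq_bigr => y _.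
Qed.

(** For one variable, evaluate the form at a vector whose entries are the
conjugate signs of its coefficients. *)
Lemma BH_base k x : unit_point x ->
  coord_sums n e [:: k] (fun x => absL x `^ BH_exponent 1) x <=
  (BH_constant mu 0 * M) `^ BH_exponent 1.
Proof.
move=> x1.
have q1 : BH_exponent 1 = 1 by rewrite /BH_exponent mulr1 divff.
have M0 : 0 <= M by rewrite (le_trans _ (LM x1))// normc_ge0.
rewrite q1 /BH_constant /series/= big_geq// mulr0 expR0 mul1r powRr1//.
rewrite /coord_sum.
pose a y := L (dfwith x k (e y)).
pose sg (z : C) : C := if z == 0 then 0 else (normc z)%:C / z.
have sgE z : sg z * z = (normc z)%:C.
  by rewrite /sg; case: eqVneq => [->|z0]; rewrite ?mulr0 ?normc0// divfK.
have sg1 z : normc (sg z) <= 1.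
  rewrite /sg; case: eqVneq => [_|z0]; first by rewrite normc0.
  rewrite normcM normcV normc_real ger0_norm ?normc_ge0// divff//.
  by apply: contra_neq z0; exact: eq0_normc.
pose l := mkseq (fun y => sg (a y)) n.
have lM : normc (L (dfwith x k (c0_vector n l))) <= M.
  apply: LM; apply: unit_dfwith => //; apply: c0_vector_le1.
  by apply/allP => z /mapP[y _ ->].
apply: le_trans lM; rewrite multilinear_vector.
rewrite (eq_bigr (fun y : 'I_n => (normc (a y))%:C)) => [|y _]; last first.
  by rewrite nth_mkseq// sgE.
rewrite -rmorph_sum normc_real; apply: le_trans (ler_norm _).
by apply: ler_sum => y _; rewrite powRr1// normc_ge0.
Qed.

(** In the mixed sum for k, the Khinchine inequality with theta = 1/(p+2)
replaces the square function over the coordinate k by an average of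
|L|^(2 - 2 theta), where the coordinate k of L is a vector of roots of unity.
This vector has norm at most 1 and 2 - 2 theta is the exponent for p + 1
variables, so that the induction hypothesis applies to the remaining
coordinates, with the coordinate k frozen.  Freezing coordinates is
why the statement concerns a set js of coordinates and an arbitrary point x of
the unit balls. *)
Lemma BH_induction (p : nat) js x : size js = p.+1 -> uniq js -> unit_point x ->
  coord_sums n e js (fun x => absL x `^ BH_exponent p.+1) x <=
  (BH_constant mu p * M) `^ BH_exponent p.+1.
Proof.
elim: p js x => [|p ih] js x sj ju x1.
  by case: js sj ju => [|k []]// _ _; exact: BH_base.
have M0 : 0 <= M by rewrite (le_trans _ (LM x1))// normc_ge0.
have C0 q : 0 <= BH_constant mu q by exact: expR_ge0.
have p1 : p.+1%:R != 0 :> R by rewrite pnatr_eq0.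
have p2 : p.+2%:R != 0 :> R by rewrite pnatr_eq0.
have pS : p.+2%:R = p.+1%:R + 1 :> R by rewrite natr1.
apply: (@blei R _ _ n e p js absL (BH_constant mu p.+1 * M) x) => //.
- by move=> z; exact: normc_ge0.
- by rewrite mulr_ge0.
move=> k kjs.
pose theta : R := p.+2%:R^-1.
have t01 : 0 <= theta < 1 by rewrite invr_ge0 ler0n/= invf_lt1// ltr1n.
have thE : p.+1%:R / p.+2%:R = 1 - theta.
  by rewrite -[p.+1%:R](addrK 1) -pS mulrBl divff// mul1r.
have qE : BH_exponent p.+1 = 2 * (1 - theta) by rewrite /BH_exponent -thE mulrA.
apply: (@le_trans _ _ (coord_sums n e (rem k js) (fun x => expR (theta * mu) *
  torus_mean N w n (fun l => absL (dfwith x k (c0_vector n l)) `^ BH_exponent p.+1)) x)).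
  apply: ler_coord_sums_all => z; rewrite thE.
  have := khinchine (fun y => L (dfwith z k (e y))) t01.
  rewrite expRN ler_pdivrMl ?expR_gt0//; move=> /le_trans; apply.
  rewrite ler_wpM2l ?expR_ge0//; apply: ler_torus_mean => // l _ _.
  rewrite qE powRrM powR_mulrn ?normc_ge0// /absL multilinear_vector.
  rewrite /steinhaus_sum (eq_bigr (fun y : 'I_n => l`_y * L (dfwith z k (c0_basis y))))//.
  by move=> y _; rewrite mulrC.
rewrite coord_sumsZ coord_sums_torus_mean.
apply: (@le_trans _ _ (expR (theta * mu) *
    torus_mean N w n (fun=> (BH_constant mu p * M) `^ BH_exponent p.+1))).
  rewrite ler_wpM2l ?expR_ge0//; apply: ler_torus_mean => // l _ l1.
  rewrite (coord_sums_dfwith n e (c0_vector n l)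
    (fun x => absL x `^ BH_exponent p.+1)) ?mem_rem_uniq ?inE ?eqxx//.
  apply: ih; rewrite ?rem_uniq ?size_rem ?sj//.
  apply: unit_dfwith => //; apply: c0_vector_le1.
  by apply: sub_all l1 => z /eqP ->.
rewrite torus_mean_cst// qE.
have -> : 2 * p.+1%:R / p.+2%:R = 2 * (1 - theta) by rewrite -mulrA thE.
rewrite !powRM//.
rewrite mulrA ler_wpM2r ?powR_ge0//.
rewrite /BH_constant -!expRM -expRD ler_expR seriesSr /harmonic/=.
rewrite le_eqVlt; apply/orP; left; apply/eqP; rewrite -thE /theta.
move: (series _ _) p1 p2 => h; move: (p.+1%:R) (p.+2%:R) => a b a0 b0.
by field; rewrite a0 b0.
Qed.

End Induction.
End BohnenblustHille.

(** * From finite sums to the optimal constant *)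

Section Main.
Context {R : realType}.
Notation C := R[i].

(** A finite set of index tuples is contained in a cube {0, ..., n-1}^I.  The
induction on js splits the set X by the value of one coordinate. *)
Lemma sum_le_coord_sums (I : finType) (n : nat) (H : (I -> c0 R) -> R)
   (X : seq (I -> nat)) (js : seq I) (x : I -> c0 R) :
  (forall x, 0 <= H x) -> uniq X ->
  (forall i k, i \in X -> k \in js -> (i k < n)%N) ->
  (forall i k, i \in X -> k \notin js -> c0_basis (i k) = x k) ->
  \sum_(i <- X) H (fun k => c0_basis (i k)) <= coord_sums n (@c0_basis R) js H x.
Proof.
move=> H0; elim: js x X => [|j js ih] x X Xu Xn Xx.
  have basis_inj : injective (@c0_basis R).
    move=> a b /(congr1 (fun u : c0 R => u a))/= /eqP.
    by rewrite (eqr_nat C) eqxx; case: (eqVneq a b).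
  case: X Xu Xn Xx => [|i X]; first by rewrite big_nil.
  move=> Xu _ Xx.
  have X0 : X = [::].
    case: X Xu Xx => // i' X /= /andP[+ _] Xx; rewrite inE negb_or => /andP[+ _].
    case/eqP; apply/funext => k; apply: basis_inj.
    by rewrite !Xx// !inE eqxx ?orbT.
  rewrite X0 big_seq1/= le_eqVlt; apply/orP; left; apply/eqP; congr H.
  by apply/funext => k; rewrite Xx// mem_head.
rewrite /= /coord_sum.
apply: (@le_trans _ _ (\sum_(y < n) \sum_(i <- X | i j == y) H (fun k => c0_basis (i k)))).
  rewrite (exchange_big_dep xpredT)//= big_seq [leRHS]big_seq; apply: ler_sum => i iX.
  have ijn := Xn i j iX (mem_head _ _).
  by rewrite (big_pred1 (Ordinal ijn)).
apply: ler_sum => y _; rewrite -big_filter; apply: ih.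
- exact: filter_uniq.
- by move=> i k; rewrite mem_filter => /andP[_ iX] kjs; rewrite Xn// inE kjs orbT.
- move=> i k; rewrite mem_filter => /andP[/eqP ijy iX] kjs.
  rewrite dfwithE; case: eqVneq => [<-|jk]; first by rewrite ijy.
  by rewrite Xx// inE negb_or eq_sym jk.
Qed.

Lemma normc_le_form_norm (m : nat) (L : ('I_m -> c0 R) -> C^o) x :
  unit_point x -> ((normc (L x))%:E <= form_norm L)%E.
Proof. by move=> x1; apply: ereal_sup_ubound; exists x. Qed.

(** The infinite sum is a supremum of finite ones, and for each of these the
order of the roots of unity is chosen according to the cube that contains its
indices; the constant does not depend on it. *)
Lemma BH_sum_le (m : nat) (L : ('I_m.+1 -> c0 R) -> C^o) (delta : R) :
  multilinear L -> 0 < delta ->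
  (BH_sum L <= (BH_constant (1 - euler_gamma R + delta) m)%:E * form_norm L)%E.
Proof.
move=> Lm d0; set mu := 1 - _ + _.
have Lge0 : (0 <= form_norm L)%E.
  apply: le_trans (normc_le_form_norm (x := fun=> 0) L _).
    by rewrite lee_fin normc_ge0.
  by move=> i; rewrite normr0.
case EM : (form_norm L) Lge0 => [M| |] //; last first.
  by move=> _; rewrite gt0_muley ?leey// lte_fin expR_gt0.
rewrite lee_fin => M0.
have LM x : unit_point x -> normc (L x) <= M.
  by move=> x1; rewrite -lee_fin -EM normc_le_form_norm.
set D := BH_constant mu m * M.
have D0 : 0 <= D by rewrite mulr_ge0// expR_ge0.
rewrite /BH_sum -EFinM -/D.
have -> : D%:E = ((D `^ BH_exponent m.+1)%:E `^ (m.+2%:R / (2 * m.+1%:R)))%E.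
  rewrite poweR_EFin -powRrM /BH_exponent [2 * _ / _]mulrC mulrACA.
  rewrite mulVf ?pnatr_eq0// mul1r mulfV ?mulf_neq0 ?pnatr_eq0//.
  by rewrite powRr1.
apply: gt0_ler_poweR.
- by rewrite divr_ge0// mulr_ge0.
- by rewrite in_itv/= leey andbT; apply: esum_ge0 => i _; rewrite lee_fin powR_ge0.
- by rewrite in_itv/= leey andbT lee_fin powR_ge0.
apply: ge_ereal_sup => _ [X [Xf _] <-].
rewrite fsbig_finite//= sumEFin lee_fin.
set Xs := enum_fset _.
(* Larger than every entry of the index tuples in [X]. *)
pose n := (\sum_(i <- Xs) \sum_(k < m.+1) i k).+1.
have [N [w [N1 wN kh]]] := steinhaus_khinchine (R := R) n d0.
have N0 : (0 < N)%N by exact: ltn_trans N1.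
have x1 : @unit_point R m.+1 (fun=> 0).
  by move=> i; rewrite normr0.
have := @BH_induction R m.+1 L Lm n M mu N w LM N0 wN kh m (enum 'I_m.+1) _
  _ (enum_uniq _) x1.
rewrite size_enum_ord => /(_ erefl); apply: le_trans.
apply: (sum_le_coord_sums (H := fun x => normc (L x) `^ BH_exponent m.+1)).
- by move=> z; exact: powR_ge0.
- exact: fset_uniq.
- move=> i k iX _; rewrite /n ltnS.
  rewrite (big_rem i)//= (bigD1 k)//= -addnA leq_addr//.
- by move=> i k _; rewrite mem_enum.
Qed.

(** With delta = 1/(m+1), the contribution of delta is bounded since
H_m <= 1 + ln (m+1) <= m + 1. *)
Lemma BH_constant_le (m : nat) :
  BH_constant (1 - euler_gamma R + m.+1%:R^-1) m <=
  expR ((1 + (1 - euler_gamma R)) / 2) * m.+1%:R `^ ((1 - euler_gamma R) / 2).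
Proof.
rewrite /BH_constant /powR pnatr_eq0/= -expRD ler_expR.
set h := series harmonic m; set g := 1 - euler_gamma R.
have g0 : 0 <= g by rewrite subr_ge0 euler_gamma_le1.
have hle : h <= 1 + ln m.+1%:R.
  apply: le_trans (harmonic_le_ln m); rewrite seriesSr lerDl.
  exact: harmonic_ge0.
have hm : m.+1%:R^-1 * h <= 1.
  rewrite mulrC ler_pdivrMr// mul1r (le_trans hle)//.
  have := ln_le_sub1 (ltr0Sn R m).
  by move: (m.+1%:R) (ln m.+1%:R) => a b; lra.
have : g * h <= g * (1 + ln m.+1%:R) by rewrite ler_wpM2l.
have -> : (g + m.+1%:R^-1) / 2 * h = (g * h) / 2 + (m.+1%:R^-1 * h) / 2 by ring.
have -> : g / 2 * ln m.+1%:R = (g * ln m.+1%:R) / 2 by ring.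
rewrite mulrDr mulr1; move: hm.
move: (_^-1 * h) (g * h) (g * ln _) => a b c; lra.
Qed.

End Main.

Theorem corollary3p2 (R : realType) :
  exists2 kappa : R, 0 < kappa &
    forall m : nat, (1 <= m)%N ->
      (BH_mult R m <= (kappa * m%:R `^ ((1 - euler_gamma R) / 2))%:E)%E.
Proof.
exists (expR ((1 + (1 - euler_gamma R)) / 2)); first exact: expR_gt0.
case=> // m _.
apply: le_trans (_ : _ <= (BH_constant (1 - euler_gamma R + m.+1%:R^-1) m)%:E)%E _; last first.
  by rewrite lee_fin BH_constant_le.
have m0 : 0 < m.+1%:R^-1 :> R by rewrite invr_gt0.
apply: ereal_inf_lbound.
exists (BH_constant (1 - euler_gamma R + m.+1%:R^-1) m) => //; split.
  apply: (@le_trans _ _ (expR 0)); first by rewrite expR0.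
  rewrite ler_expR mulr_ge0//.
    apply: divr_ge0 => //; apply: addr_ge0; last exact: ltW.
    by rewrite subr_ge0 euler_gamma_le1.
  by apply: sumr_ge0 => i _; exact: harmonic_ge0.
by move=> L [Lm _]; exact: BH_sum_le.
Qed.
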